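(* For any prime $p$, there exist a field $K$ and a central division $K$-algebra $\mathcal{D}$ of degree $p$ whose genus $\mathbf{gen}(\mathcal{D})$ is infinite.
   Context: For a finite-dimensional central division algebra $\mathcal{D}$ over a field $F$, the genus $\mathbf{gen}(\mathcal{D})$ is the set of classes $[\mathcal{D}']\in \mathrm{Br}(F)$ of central division $F$-algebras $\mathcal{D}'$ having the same maximal subfields as $\mathcal{D}$; that is, $\mathcal{D}'$ has the same degree $n$ as $\mathcal{D}$, and a field extension $E/F$ of degree $n$ admits an $F$-embedding into $\mathcal{D}$ if and only if it admits an $F$-embedding into $\mathcal{D}'$. *)

(* Defs.v *)
From HB Require Import structures.
From mathcomp Require Import all_boot all_order all_algebra all_field.
Set Implicit Arguments.
Unset Strict Implicit.
Unset Printing Implicit Defensive.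
Import GRing.Theory.
Local Open Scope ring_scope.

Definition is_division (K : fieldType) (A : falgType K) : Prop :=
  forall x : A, x != 0 -> x \is a GRing.unit.

Definition is_central (K : fieldType) (A : falgType K) : Prop :=
  'Z({:A})%VS = 1%VS.

Definition central_division_of_degree (K : fieldType) (n : nat)
  (A : falgType K) : Prop :=
  [/\ is_division A, is_central A & \dim {:A} = (n ^ 2)%N].

(* The field extension E/K admits a K-embedding into A
   (a unital K-algebra homomorphism; injective since E is a field). *)
Definition embeds_into (K : fieldType) (E : fieldExtType K)
  (A : falgType K) : Prop :=
  exists f : 'AHom(E, A), True.

Definition falg_iso (K : fieldType) (A B : falgType K) : Prop :=
  exists f : 'AHom(A, B), bijective f.

Definition in_genus (K : fieldType) (n : nat) (D D' : falgType K) : Prop :=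
  central_division_of_degree n D' /\
  forall E : fieldExtType K, \dim {:E} = n ->
    (embeds_into E D <-> embeds_into E D').

(* The genus of D is infinite: there are infinitely many pairwise distinct
   Brauer classes of members of the genus. Division algebras are
   Brauer-equivalent iff isomorphic, so we ask for a sequence of members
   that are pairwise non-isomorphic. *)
Definition genus_infinite (K : fieldType) (n : nat) (D : falgType K) : Prop :=
  exists Ds : nat -> falgType K,
    (forall i, in_genus n D (Ds i)) /\
    (forall i j, i <> j -> ~ falg_iso (Ds i) (Ds j)).

(* Main.v *)
(* Let [K] be the fixed field of an automorphism [sg] of order [p] of a field [F], with a primitive
   [p]-th root of unity in [K], and let [D_i] be the cyclic algebra of [sg] with [y^p = b_i].  If
   the [b_i] are independent modulo [p]-th powers in [K^* / N(F^* )], then the [D_i] are division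
   algebras and pairwise non-isomorphic.  A field [K[T]/(f)] of degree [p] other than [F] embeds
   into [D_i] iff some matrix [H] over [F] commutes with the companion matrix [C] of [f] and has
   twisted norm [H sg(H) ... sg^(p-1)(H) = b_i].  Given such an [H] and an index [j], a matrix [Z]
   commuting with [C] and of twisted norm [b_j] can be adjoined generically: the new pair [(F', sg')]
   lies inside two function fields with twisted automorphisms, and by Amitsur's theorem an element
   of [K] that becomes a norm from [F'] is a norm from [F] up to a power of [b_j], and also up to a
   power of [b_j b_i].  This is incompatible with a new relation between the [b_k].  Starting with
   countable [F], countably many such steps and a direct limit yield a pair for which every such [H]
   has its [Z], so that all the [D_i] have the same maximal subfields. *)
Require Import Defs.
From HB Require Import structures.
From mathcomp Require Import all_boot all_order all_algebra all_field.
From mathcomp Require Import boolp zify.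
Set Implicit Arguments.
Unset Strict Implicit.
Unset Printing Implicit Defensive.
Import GRing.Theory Num.Theory.
Local Open Scope ring_scope.

(** * Factorial rings *)

(** Why a matrix [H] records an embedding: if [d] in [D_i] is a root of [f], and [f] has no root in
    [F], the powers of [d] form a basis of [D_i] as a left [F]-space. Right multiplication by [d]
    becomes [C]; left multiplication by [y], semilinear and commuting with it, becomes [H], and
    [y^p = b_i] becomes the norm equation. Conversely [Z] turns the row space into a left
    [D_j]-module of [F]-dimension [p], hence a copy of [D_j], on which [C] is right multiplication
    by a root of [f]. The obstacle is that adjoining [Z] might create relations between the [b_k]: a
    function field attached to [b_j] makes [b_j] itself a norm. Here the given [H] helps. Twisting
    the semilinear action on the variables by [H] changes its [p]-th power from [b_j] to [b_j b_i]
    but does not change its effect on [Z], so the field generated by [Z] also lies in a function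
    field that makes only powers of [b_j b_i] into norms. Modulo norms, the groups generated by
    [b_j] and by [b_j b_i] meet trivially. Amitsur's theorem is proved by descent on leading forms,
    cancelling one prime factor at a time; this is the use of factorial rings. *)

Section Primes.
Variable R : idomainType.
Implicit Types a b c q : R.

Definition dvdr q a := exists c, a = q * c.

Definition prime_elt q :=
  [/\ q != 0, q \isn't a GRing.unit &
      forall a b, dvdr q (a * b) -> dvdr q a \/ dvdr q b].

Inductive factored : nat -> R -> Prop :=
| factored_unit u : u \is a GRing.unit -> factored 0 u
| factored_mul n q a : prime_elt q -> factored n a -> factored n.+1 (q * a).

Lemma factored_unitM n u a :
  u \is a GRing.unit -> factored n a -> factored n (u * a).
Proof.
move=> uu; elim=> [v uv|m q b pq _ IH]; first by apply: factored_unit; rewrite unitrM uu.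
by rewrite mulrCA; apply: factored_mul.
Qed.

Lemma factored_prod m n a b :
  factored m a -> factored n b -> factored (m + n) (a * b).
Proof.
move=> fa fb; elim: fa => [u uu|k q c pq _ IH]; first exact: factored_unitM.
by rewrite -mulrA addSn; apply: factored_mul.
Qed.

Lemma factored_split n c : factored n c -> forall a b, c = a * b ->
  exists n1 n2, [/\ n = (n1 + n2)%N, factored n1 a & factored n2 b].
Proof.
elim=> [u uu a b eab|m q d pq _ IH a b eab].
  move: uu; rewrite eab unitrM => /andP[ua ub].
  by exists 0, 0; split=> //; apply: factored_unit.
have [q0 _ qP] := pq.
have [|[a' ea]|[b' eb]] := qP a b; first by exists d.
- have /IH[n1 [n2 [-> f1 f2]]] : d = a' * b.
    by apply: (mulfI q0); rewrite eab ea mulrA.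
  by exists n1.+1, n2; split=> //; rewrite ea; apply: factored_mul.
- have /IH[n1 [n2 [-> f1 f2]]] : d = a * b'.
    by apply: (mulfI q0); rewrite eab eb mulrCA.
  by exists n1, n2.+1; split=> //; rewrite ?addnS // eb; apply: factored_mul.
Qed.

Lemma factored0_unit a : factored 0 a -> a \is a GRing.unit.
Proof. by move=> f; inversion f. Qed.

Lemma factored_prime n a : factored n a -> a \isn't a GRing.unit ->
  exists2 q, prime_elt q & dvdr q a.
Proof. by case=> [u -> //|m q b pq _ _]; exists q => //; exists b. Qed.

(** The factors are primes, not merely irreducibles, so existence alone is the full notion:
    uniqueness is automatic. *)
Definition factorial_ring := forall a, a != 0 -> exists n, factored n a.

Definition irreducible_elt a := a \isn't a GRing.unit /\
  forall b c, a = b * c -> b \is a GRing.unit \/ c \is a GRing.unit.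

Lemma dvdr_prod_prime q I (s : seq I) (F : I -> R) :
  prime_elt q -> dvdr q (\prod_(i <- s) F i) ->
  exists i, dvdr q (F i).
Proof.
move=> [q0 qu qP]; elim: s => [|i s IH]; rewrite ?big_nil ?big_cons.
  by move=> [c e]; case/negP: qu; apply/unitrPr; exists c.
by case/qP => [|/IH//]; exists i.
Qed.

End Primes.

Section Gauss.
Variable R : idomainType.
Hypothesis facR : factorial_ring R.
Implicit Types f g h : {poly R}.

(** If [q] divides [f * g], it divides the product of the leading coefficients, hence one of them.
    Removing the corresponding leading term keeps the product divisible by [q], and induction on the
    total size applies. *)
Lemma prime_polyC (q : R) : prime_elt q -> prime_elt q%:P.
Proof.
move=> [q0 qu qP]; split; first by rewrite polyC_eq0.
  by rewrite poly_unitE size_polyC q0 coefC eqxx.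
move=> f g; have [n] := ubnP (size f + size g)%N; elim: n f g => // n IH f g ltn [h fgh].
have [->|f0] := eqVneq f 0; first by left; exists 0; rewrite mulr0.
have [->|g0] := eqVneq g 0; first by right; exists 0; rewrite mulr0.
have red (u : {poly R}) c : u != 0 -> lead_coef u = q * c ->
    (size (u - (q * c) *: 'X^((size u).-1))%R < size u)%N.
  move=> u0 lu; rewrite -[X in (_ < X)%N]prednK ?size_poly_gt0 // ltnS.
  apply/leq_sizeP => j lej; rewrite coefB coefZ coefXn.
  move: lej; rewrite leq_eqVlt => /orP[/eqP <-|ltj].
    by rewrite eqxx mulr1 -lu lead_coefE subrr.
  by rewrite gtn_eqF // mulr0 subr0 nth_default // -[size u]prednK ?size_poly_gt0.
have lfg : lead_coef f * lead_coef g = q * lead_coef h.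
  by rewrite -lead_coefM fgh lead_coefM lead_coefC.
have [|[c lc]|[c lc]] := qP (lead_coef f) (lead_coef g); first by exists (lead_coef h).
- set m := (size f).-1 in red; case: (IH (f - (q * c) *: 'X^m) g).
  + by rewrite ltnS in ltn; apply: leq_trans _ ltn; rewrite ltn_add2r (red _ c).
  + exists (h - c *: 'X^m * g); rewrite mulrBl fgh mulrBr -scalerA -!mul_polyC.
    by rewrite !mulrA.
  + move=> [k ek]; left; exists (k + c *: 'X^m).
    by rewrite mulrDr -ek -scalerA mul_polyC subrK.
  + by right.
- set m := (size g).-1 in red; case: (IH f (g - (q * c) *: 'X^m)).
  + by rewrite ltnS in ltn; apply: leq_trans _ ltn; rewrite ltn_add2l (red _ c).
  + exists (h - c *: 'X^m * f); rewrite mulrBr fgh mulrBr -scalerA -!mul_polyC.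
    by congr (_ - _); rewrite mulrC !mulrA.
  + by left.
  + move=> [k ek]; right; exists (k + c *: 'X^m).
    by rewrite mulrDr -ek -scalerA mul_polyC subrK.
Qed.

(** The primes of [c] remain prime in [{poly R}], so they can be distributed one by one between [g]
    and [h]. This brings factorizations up to constants, such as those given by pseudo-division,
    back to [R]. *)
Lemma const_split n (c : R) : factored n c -> forall f g h, c *: f = g * h ->
  exists c1 c2 g' h', [/\ c = c1 * c2, g = c1 *: g', h = c2 *: h' & f = g' * h'].
Proof.
elim=> [u uu f g h e|m q d pq _ IH f g h e].
  exists u, 1, (u^-1 *: g), h; rewrite mulr1 scale1r scalerA mulrV // scale1r.
  by split=> //; rewrite -scalerAl -e scalerA mulVr // scale1r.
have [q0 _ _] := pq; have [_ _ qP] := prime_polyC pq.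
have [|[g' eg]|[h' eh]] := qP g h.
- by exists (d *: f); rewrite -e mul_polyC scalerA.
- have /IH[c1 [c2 [g1 [h1 [-> e1 -> ->]]]]] : d *: f = g' * h.
    apply: (mulfI (_ : q%:P != 0)); first by rewrite polyC_eq0.
    by rewrite mulrA -eg -e mul_polyC scalerA.
  exists (q * c1), c2, g1, h1; split=> //; rewrite ?mulrA //.
  by rewrite eg e1 mul_polyC scalerA.
- have /IH[c1 [c2 [g1 [h1 [-> -> e2 ->]]]]] : d *: f = g * h'.
    apply: (mulfI (_ : q%:P != 0)); first by rewrite polyC_eq0.
    by rewrite mulrCA -eh -e mul_polyC scalerA.
  exists c1, (q * c2), g1, h1; split=> //; first by rewrite mulrCA.
  by rewrite eh e2 mul_polyC scalerA.
Qed.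

Lemma unit_polyC_size f : f \is a GRing.unit -> size f = 1.
Proof. by rewrite poly_unitE => /andP[/eqP]. Qed.

Lemma irr_dvd_cancel f h (c : R) : irreducible_elt f -> (1 < size f)%N -> c != 0 ->
  dvdr f (c *: h) -> dvdr f h.
Proof.
move=> [fu fP] sf c0 [t e]; have [n fc] := facR c0.
have [c1 [c2 [f1 [t1 [_ ef et ->]]]]] := const_split fc e.
have [|c1u|/unit_polyC_size f1u] := fP c1%:P f1; first by rewrite mul_polyC.
  move: c1u; rewrite poly_unitE coefC /= => /andP[_ c1u].
  by exists (c1^-1 *: t1); rewrite ef -scalerAr -scalerAl scalerA mulVr // scale1r.
move: sf; rewrite ef ltnNge (leq_trans (size_scale_leq _ _)) // f1u //.
Qed.

(** If [f] divides no nonzero constant multiple of [g], irreducibility makes their pseudo-gcd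
    constant. Bezout then writes a nonzero constant as a combination of [f] and [g]; multiplying by
    [h] shows that [f] divides a constant multiple of [h], and the constant cancels. *)
Lemma irr_poly_prime f : irreducible_elt f -> (1 < size f)%N -> prime_elt f.
Proof.
move=> irf sf; have [fu fP] := irf; have f0: f != 0 by rewrite -size_poly_gt0 ltnW.
split=> // g h fgh; have [[c c0 dcg]|nfg] := pselect (exists2 c, c != 0 & dvdr f (c *: g)).
  by left; apply: (irr_dvd_cancel irf sf c0).
right; set d := gcdp f g.
have d0 : d != 0 by rewrite gcdp_eq0 negb_and f0.
have /Pdiv.Idomain.dvdpP[[c q] /= c0 ef] := dvdp_gcdl f g.
have /Pdiv.Idomain.dvdpP[[c' q'] /= c'0 eg] := dvdp_gcdr f g.
have [n fc] := facR c0.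
have [c1 [c2 [q1 [d1 [ec eq ed ef1]]]]] := const_split fc ef.
have c20 : c2 != 0 by apply: contraNneq c0 => c20; rewrite ec c20 mulr0.
have [q1u|/unit_polyC_size d1u] := fP _ _ ef1.
  case: nfg; exists c' => //; exists (c2 *: (q1^-1 * q')).
  by rewrite eg ed -!scalerAr ef1; congr (_ *: _); rewrite -mulrA (mulrCA d1) mulVKr // mulrC.
have [[u v] /= uv] := Pdiv.Idomain.Bezoutp f g.
have sd : size d = 1.
  by rewrite /d ed size_scale.
have : size (u * f + v * g) == 1 by rewrite (eqp_size uv) sd.
move=> /size_poly1P[k k0 ek].
apply: (irr_dvd_cancel irf sf k0); have [w ew] := fgh.
exists (u * h + v * w); rewrite -mul_polyC -ek mulrDl mulrDr.
by rewrite -!mulrA ew; congr (_ + _); rewrite mulrCA.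
Qed.

Lemma factored_polyC n (c : R) : factored n c -> factored n c%:P.
Proof.
elim=> [u uu|m q a pq _ IH].
  have u0 : u != 0 by apply: contraTneq uu => ->; rewrite unitr0.
  by apply: factored_unit; rewrite poly_unitE coefC /= uu andbT size_polyC u0.
by rewrite polyCM; apply: factored_mul => //; apply: prime_polyC.
Qed.

(** Induction on the size plus the number [n] of prime factors of the leading coefficient. In a
    proper factorization the measures of the factors add up to one more than that of [f], and a
    nonunit has measure at least 2, so both measures drop. *)
Lemma factorial_poly : factorial_ring {poly R}.
Proof.
suff H k : forall f n, f != 0 -> factored n (lead_coef f) -> (size f + n < k)%N ->
    exists m, factored m f.
  move=> f f0; have lf0 : lead_coef f != 0 by rewrite lead_coef_eq0.
  have [n fn] := facR lf0; exact: H fn (ltnSn _).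
elim: k => // k IH f n f0 fn; rewrite ltnS => lek.
have [fu|fu] := boolP (f \is a GRing.unit); first by exists 0; apply: factored_unit.
have [irf|] := pselect (irreducible_elt f).
  have [sf|sf] := leqP (size f) 1.
    by move: fn; rewrite (size1_polyC sf) lead_coefC => fn; exists n; apply: factored_polyC.
  exists 1; rewrite -[f]mulr1; apply: factored_mul; first exact: irr_poly_prime.
  by apply: factored_unit; rewrite unitr1.
move=> nirr; have [g [h [ef gu hu]]] : exists g h, [/\ f = g * h,
    g \isn't a GRing.unit & h \isn't a GRing.unit].
  apply: contrapT => nex; apply: nirr; split=> // g h ef; apply: contrapT => ngh.
  apply: nex; exists g, h; split=> //; apply/negP => ?; apply: ngh; [by left|by right].
have /andP[g0 h0] : (g != 0) && (h != 0) by move: f0; rewrite ef mulf_eq0 negb_or.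
have [n1 [n2 [en f1 f2]]] : exists n1 n2, [/\ n = (n1 + n2)%N,
    factored n1 (lead_coef g) & factored n2 (lead_coef h)].
  by apply: (factored_split fn); rewrite ef lead_coefM.
have mu (u : {poly R}) i : u != 0 -> u \isn't a GRing.unit ->
    factored i (lead_coef u) -> (1 < size u + i)%N.
  move=> u0 uu fi; rewrite ltnNge; apply: contra uu => le1.
  have su : size u = 1 by apply/eqP; rewrite eqn_leq size_poly_gt0 u0 (leq_trans _ le1) ?leq_addr.
  have i0 : i = 0 by move: le1; rewrite su; case: i fi.
  rewrite poly_unitE su eqxx /=; move: fi; rewrite i0 => /factored0_unit.
  by rewrite lead_coefE su.
have sf : (size f).+1 = (size g + size h)%N.
  by rewrite ef size_mul // prednK // addn_gt0 size_poly_gt0 g0.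
have mg := mu _ _ g0 gu f1; have mh := mu _ _ h0 hu f2.
have e : ((size f + n).+1 = (size g + n1) + (size h + n2))%N.
  by rewrite -addSn sf en addnACA.
have [m1 fm1] : exists m, factored m g.
  by apply: (IH _ _ g0 f1); apply: leq_trans lek; rewrite -ltnS e -[(_ + _).+1]addn1 ltn_add2l.
have [m2 fm2] : exists m, factored m h.
  by apply: (IH _ _ h0 f2); apply: leq_trans lek; rewrite -ltnS e -[X in (X < _)%N]add1n ltn_add2r.
by exists (m1 + m2)%N; rewrite ef; apply: factored_prod.
Qed.

End Gauss.

(** * Iterated polynomial rings and semilinear automorphisms *)

Section IterPoly.
Variable R : idomainType.

Fixpoint itp (n : nat) : idomainType :=
  if n is m.+1 then [the idomainType of {poly itp m}] else R.

Fixpoint cst (n : nat) : {rmorphism R -> itp n} :=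
  if n is m.+1 then [the {rmorphism R -> itp m.+1} of polyC \o cst m]
  else [the {rmorphism R -> itp 0} of idfun].

Fixpoint var (n i : nat) : itp n :=
  if n is m.+1 then (if i == m then ('X : itp m.+1) else ((var m i)%:P : itp m.+1)) else 0.

Fixpoint evl (S : comNzRingType) (g : {rmorphism R -> S}) (h : nat -> S) (n : nat) :
    {rmorphism itp n -> S} :=
  if n is m.+1 then
    [the {rmorphism itp m.+1 -> S} of horner_eval (h m) \o map_poly (evl g h m)]
  else [the {rmorphism itp 0 -> S} of g].

Lemma evl_cst (S : comNzRingType) (g : {rmorphism R -> S}) h n c : evl g h n (cst n c) = g c.
Proof. by elim: n => //= n IH; rewrite /horner_eval map_polyC hornerC. Qed.

Lemma evl_var (S : comNzRingType) (g : {rmorphism R -> S}) h n i : (i < n)%N -> evl g h n (var n i) = h i.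
Proof.
elim: n => //= n IH; rewrite ltnS /horner_eval; case: eqVneq => [->|ni lei].
  by rewrite map_polyX hornerX.
by rewrite map_polyC hornerC /= IH // ltn_neqAle ni.
Qed.

Lemma itp_ext (S : nzRingType) n (f1 f2 : {rmorphism itp n -> S}) :
  (forall c, f1 (cst n c) = f2 (cst n c)) ->
  (forall i, (i < n)%N -> f1 (var n i) = f2 (var n i)) -> f1 =1 f2.
Proof.
elim: n f1 f2 => [|n IH] f1 f2 Hc Hv a; first exact: Hc.
have H0 c : f1 c%:P = f2 c%:P.
  have := IH [the {rmorphism itp n -> S} of f1 \o polyC] [the {rmorphism itp n -> S} of f2 \o polyC].
  apply => [d|i lti] /=; first exact: Hc.
  by have := Hv i (leqW lti); rewrite /= ltn_eqF.
have HX : f1 ('X : {poly itp n}) = f2 ('X : {poly itp n}).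
  by have := Hv n (leqnn _); rewrite /= eqxx.
elim/poly_ind: a => [|a c IHa]; first by rewrite !rmorph0.
by rewrite !(rmorphD, rmorphM) IHa H0 HX.
Qed.

Lemma cst_inj n : injective (cst n).
Proof. by elim: n => [|n IH] //= a b /polyC_inj/IH. Qed.

Definition countably (T : Type) := exists c : T -> nat, injective c.

Lemma countably_itp n : countably R -> countably (itp n).
Proof.
move=> cR; elim: n => [|n [c cI]] //=.
exists (fun p => pickle (map c (polyseq p))) => p q /(pcan_inj pickleK) /(inj_map cI).
exact: val_inj.
Qed.

End IterPoly.

Lemma factorial_itp (L : fieldType) n : factorial_ring (itp L n).
Proof.
elim: n => [|n IH]; last exact: factorial_poly.
by move=> a a0; exists 0; apply: factored_unit; rewrite unitfE.
Qed.

Section IterMorph.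
Variables (R : nzRingType) (f : {rmorphism R -> R}).

Fixpoint iterm (n : nat) : {rmorphism R -> R} :=
  if n is m.+1 then [the {rmorphism R -> R} of f \o iterm m]
  else [the {rmorphism R -> R} of idfun].

Lemma itermE n a : iterm n a = iter n f a.
Proof. by elim: n => //= n ->. Qed.
End IterMorph.

Lemma iter_fixed (T : Type) (f : T -> T) a k : f a = a -> iter k f a = a.
Proof. by move=> fa; elim: k => //= k ->. Qed.

Lemma iter_morph (A B : Type) (f : A -> A) (g : B -> B) (h : A -> B) k a :
  (forall a, g (h a) = h (f a)) -> iter k g (h a) = h (iter k f a).
Proof. by move=> H; elim: k => //= k ->. Qed.

Lemma iter_map_poly (R : nzRingType) (s : {rmorphism R -> R}) k (a : {poly R}) :
  iter k (map_poly s) a = map_poly (iterm s k) a.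
Proof.
elim: k => [|k IH]; first by rewrite map_poly_id.
by rewrite iterS IH; apply/polyP => i; rewrite !coef_map.
Qed.

Definition nrm (R : comNzRingType) (f : R -> R) (p : nat) (a : R) : R :=
  \prod_(i < p) iter i f a.

Lemma nrmM (R : comNzRingType) (f : {rmorphism R -> R}) p :
  {morph nrm f p : a b / a * b}.
Proof.
move=> a b; rewrite /nrm -big_split /=; apply: eq_bigr => i _.
by rewrite -!itermE rmorphM.
Qed.

Lemma nrm1 (R : comNzRingType) (f : {rmorphism R -> R}) p : nrm f p 1 = 1.
Proof. by apply: big1 => i _; rewrite -itermE rmorph1. Qed.

Lemma nrmX (R : comNzRingType) (f : {rmorphism R -> R}) p a n :
  nrm f p (a ^+ n) = nrm f p a ^+ n.
Proof. by elim: n => [|n IH]; rewrite ?expr0 ?nrm1 // !exprS nrmM IH. Qed.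

Lemma nrm_fix (R : comNzRingType) (f : R -> R) p a : f a = a -> nrm f p a = a ^+ p.
Proof.
move=> fa; rewrite /nrm (eq_bigr (fun=> a)) ?prodr_const ?card_ord // => i _.
by elim: (val i) => //= n ->.
Qed.

Lemma nrm_morph (R S : comNzRingType) (f : R -> R) (g : S -> S) (h : {rmorphism R -> S}) p a :
  (forall a, h (f a) = g (h a)) -> h (nrm f p a) = nrm g p (h a).
Proof.
move=> hfg; rewrite rmorph_prod; apply: eq_bigr => i _.
by elim: (val i) => //= n <-.
Qed.

(** The product telescopes. When [f] has order [p] this makes the norm invariant; when the [p]-th
    iterate of [f] rescales [a], it gives the factor by which [f] changes the norm. *)
Lemma nrm_iter (R : comNzRingType) (f : {rmorphism R -> R}) p a :
  f (nrm f p a) * a = nrm f p a * iter p f a.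
Proof.
elim: p => [|n IH]; first by rewrite /nrm !big_ord0 rmorph1.
by rewrite /nrm !big_ord_recr /= -/(nrm f n a) rmorphM mulrAC IH.
Qed.

Lemma nrm_eq0 (R : idomainType) (f : {rmorphism R -> R}) p a :
  injective f -> a != 0 -> nrm f p a != 0.
Proof.
move=> fI a0; apply/prodf_neq0 => i _; rewrite -itermE.
elim: (val i) => //= n IH; by rewrite -(rmorph0 f) (inj_eq fI).
Qed.

(** * Amitsur's theorem *)

Section Amitsur.
Variables (L : fieldType) (s : {rmorphism L -> L}) (p : nat) (N : nat).
Hypothesis p_gt0 : (0 < p)%N.
Hypothesis sp : forall a, iter p s a = a.
Let S := itp L N.
Variables (t : {rmorphism S -> S}) (l : L).
Hypothesis l0 : l != 0.
Hypothesis tc : forall c, t (cst L N c) = cst L N (s c).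
Hypothesis tI : injective t.

(* [a (x_i) |-> a (x_i T)]: the coefficients are the homogeneous components of [a]. *)
Definition grad : {rmorphism S -> {poly S}} :=
  evl [the {rmorphism L -> {poly S}} of polyC \o cst L N] (fun i => var L N i *: 'X) N.

Hypothesis tg : forall i, (i < N)%N -> grad (t (var L N i)) = map_poly t (grad (var L N i)).
Hypothesis tp : forall i, (i < N)%N -> iter p t (var L N i) = cst L N l * var L N i.

Lemma grad_t a : grad (t a) = map_poly t (grad a).
Proof.
apply: (itp_ext (f1 := [the {rmorphism _ -> _} of grad \o t])
   (f2 := [the {rmorphism S -> {poly S}} of map_poly t \o grad])) => [c|i lti] /=.
  by rewrite tc !evl_cst /= map_polyC /= tc.
exact: tg.
Qed.

Lemma iter_cst n c : iter n t (cst L N c) = cst L N (iter n s c).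
Proof. by elim: n => //= n ->; rewrite tc. Qed.

(** The [p]-th iterate of [t] fixes the constants and multiplies each variable by [l]. On graded
    elements this is the substitution of [l T] for the grading variable [T]: two ring morphisms that
    agree on generators. *)
Lemma grad_iter_coef a d : iter p t (grad a)`_d = cst L N (l ^+ d) * (grad a)`_d.
Proof.
have H b : map_poly (iterm t p) (grad b) = grad b \Po (cst L N l *: 'X).
  apply: (itp_ext (f1 := [the {rmorphism S -> {poly S}} of map_poly (iterm t p) \o grad])
    (f2 := [the {rmorphism S -> {poly S}} of comp_poly (cst L N l *: 'X) \o grad])) => [c|i lti] /=.
    by rewrite !evl_cst /= map_polyC comp_polyC /= itermE iter_cst sp.
  rewrite !evl_var //= map_polyZ map_polyX comp_polyZ comp_polyX /= itermE tp //.
  by rewrite scalerA mulrC.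
rewrite -itermE -coef_map /= H comp_polyE coef_sum.
transitivity (\sum_(i < size (grad a)) (grad a)`_i * (cst L N l ^+ d * (d == i)%:R)).
  by apply: eq_bigr => i _; rewrite coefZ exprZn coefZ coefXn; case: eqVneq => [->|]; rewrite ?mulr0.
case: (ltnP d (size (grad a))) => hd; last first.
  rewrite [X in _ * X](nth_default _ hd) mulr0 big1 // => i _.
  by rewrite gtn_eqF ?mulr0 // (leq_trans (ltn_ord i)).
rewrite (bigD1 (Ordinal hd)) //= eqxx mulr1 big1 ?addr0 => [|i ni]; last first.
  by rewrite eq_sym -val_eqE in ni; rewrite (negbTE ni) !mulr0.
by rewrite mulrC rmorphXn.
Qed.

Lemma horner1_grad a : (grad a).[1] = a.
Proof.
apply: (itp_ext (f1 := [the {rmorphism S -> S} of horner_eval 1 \o grad])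
    (f2 := [the {rmorphism S -> S} of idfun])) => [c|i lti] /=.
  by rewrite evl_cst /horner_eval hornerC.
by rewrite evl_var // /horner_eval hornerZ hornerX mulr1.
Qed.

Lemma horner0_grad a : exists c, (grad a).[0] = cst L N c.
Proof.
exists (evl [the {rmorphism L -> L} of idfun] (fun=> 0) N a).
apply: (itp_ext (f1 := [the {rmorphism S -> S} of horner_eval 0 \o grad])
    (f2 := [the {rmorphism S -> S} of cst L N \o evl [the {rmorphism L -> L} of idfun] (fun=> 0) N]))
     => [c|i lti] /=.
  by rewrite !evl_cst /horner_eval hornerC.
by rewrite !evl_var // /horner_eval hornerZ hornerX mulr0 rmorph0.
Qed.

Lemma grad_neq0 a : a != 0 -> grad a != 0.
Proof. by apply: contra_neq => e; rewrite -(horner1_grad a) e horner0. Qed.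

Lemma grad_size1 a : (size (grad a) <= 1)%N -> exists c, a = cst L N c.
Proof.
move=> /size1_polyC e; have [c ec] := horner0_grad a; exists c.
by rewrite -ec -[LHS]horner1_grad e !hornerC.
Qed.

Definition top a := lead_coef (grad a).

Lemma topM a b : top (a * b) = top a * top b.
Proof. by rewrite /top rmorphM lead_coefM. Qed.

Lemma top_t a : top (t a) = t (top a).
Proof. by rewrite /top grad_t lead_coef_map_inj // rmorph0. Qed.

Lemma top_cst c : top (cst L N c) = cst L N c.
Proof. by rewrite /top evl_cst lead_coefC. Qed.

Lemma top_nrm a : top (nrm t p a) = nrm t p (top a).
Proof.
rewrite /nrm; elim/big_rec2: _ => [|i b c _ <-].
  by rewrite /top rmorph1 lead_coefC.
by rewrite topM; congr (_ * _); elim: (val i) => //= n <-; rewrite top_t.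
Qed.

Lemma top_neq0 a : a != 0 -> top a != 0.
Proof. by move=> a0; rewrite lead_coef_eq0 grad_neq0. Qed.

Lemma iter_top a : iter p t (top a) = cst L N (l ^+ (size (grad a)).-1) * top a.
Proof. exact: grad_iter_coef. Qed.

(** Grading twice, with two grading variables, is the same as grading once by their product;
    comparing coefficients shows that each component is homogeneous. *)
Lemma grad_top a : grad (top a) = top a *: 'X^((size (grad a)).-1).
Proof.
have tr (b : S) : map_poly grad (grad b) = (map_poly polyC (grad b)) \Po ('X%:P * 'X : {poly {poly S}}).
  apply: (itp_ext (f1 := [the {rmorphism S -> {poly {poly S}}} of map_poly grad \o grad])
    (f2 := [the {rmorphism S -> {poly {poly S}}} of
      comp_poly ('X%:P * 'X) \o (map_poly polyC \o grad)])) => [c|i lti] /=.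
    by rewrite !evl_cst /= !map_polyC comp_polyC /= evl_cst.
  rewrite !evl_var //= !map_polyZ !map_polyX comp_polyZ comp_polyX /= evl_var //.
  by rewrite -!mul_polyC polyCM mulrA.
rewrite /top lead_coefE; set d := (size _).-1.
have := congr1 (fun q : {poly {poly S}} => q`_d) (tr a).
rewrite coef_map /= => ->; rewrite comp_polyE coef_sum size_map_polyC.
under eq_bigr => i _ do rewrite coefZ coef_map /= exprMn -rmorphXn coefCM coefXn.
have [a0|a0] := eqVneq (grad a) 0.
  by rewrite a0 size_poly0 big_ord0 coef0 scale0r.
have hd : (d < size (grad a))%N by rewrite prednK // size_poly_gt0.
rewrite (bigD1 (Ordinal hd)) //= eqxx mulr1 big1 ?addr0 => [|i ni]; last first.
  by rewrite eq_sym -val_eqE in ni; rewrite (negbTE ni) !mulr0.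
by rewrite mul_polyC.
Qed.

Definition deg a := (size (grad a)).-1.

Lemma degM a b : a != 0 -> b != 0 -> deg (a * b) = (deg a + deg b)%N.
Proof.
move=> /grad_neq0 a0 /grad_neq0 b0; rewrite /deg rmorphM size_mul //.
move: a0 b0; rewrite -!size_poly_gt0; case: (size _) => // i _; case: (size _) => // j _ /=.
by rewrite ?addSn ?addnS.
Qed.

Lemma deg_cst c : deg (cst L N c) = 0%N.
Proof. by rewrite /deg evl_cst /= size_polyC; case: (_ == _). Qed.

Lemma deg_iter n a : deg (iter n t a) = deg a.
Proof. by elim: n => //= n <-; rewrite /deg grad_t size_map_inj_poly ?rmorph0. Qed.

Lemma deg_nrm a : a != 0 -> deg (nrm t p a) = (p * deg a)%N.
Proof.
move=> a0; rewrite /nrm; elim: p => [|n IH].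
  by rewrite big_ord0 mul0n -(rmorph1 (cst L N)) deg_cst.
have i0 : iter n t a != 0 by elim: (n) => //= k ik; rewrite -(rmorph0 t) (inj_eq tI).
rewrite big_ord_recr degM ?IH ?deg_iter ?mulSnr //.
exact: (nrm_eq0 n tI a0).
Qed.

Lemma deg_top a : a != 0 -> deg (top a) = deg a.
Proof.
move=> a0; rewrite {1}/deg grad_top size_scale ?top_neq0 // size_polyXn.
by [].
Qed.

Lemma deg0_cst a : deg a = 0%N -> exists c, a = cst L N c.
Proof. by rewrite /deg => d0; apply: grad_size1; move: d0; case: (size _) => [|[]]. Qed.

Lemma unit_deg0 a : a \is a GRing.unit -> deg a = 0%N.
Proof.
move=> ua; have a0 : a != 0 by apply: contraTneq ua => ->; rewrite unitr0.
have b0 : a^-1 != 0 by rewrite invr_eq0.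
apply/eqP; rewrite -leqn0; apply: leq_trans (leq_addr (deg a^-1) _) _.
by rewrite -degM // divrr // -(rmorph1 (cst L N)) deg_cst.
Qed.

Lemma iter_topE n a : iter n t (top a) = top (iter n t a).
Proof. by elim: n => //= n ->; rewrite top_t. Qed.

(** By [nrm_iter] and [iter_top], each application of [t] multiplies the norm of a leading form by
    [l ^ deg a]. This is where the powers of [l] in Amitsur's theorem arise. *)
Lemma nrm_iter_top n a : a != 0 ->
  nrm t p (iter n t (top a)) = cst L N (l ^+ (n * deg a)) * nrm t p (top a).
Proof.
move=> a0; elim: n => [|n IH]; first by rewrite mul0n expr0 rmorph1 mul1r.
have i0 : iter n t a != 0 by elim: (n) => //= k ik; rewrite -(rmorph0 t) (inj_eq tI).
have := nrm_iter t p (iter n t (top a)); rewrite {2 4}iter_topE iter_top -/(deg _) deg_iter.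
rewrite mulrA => /(mulIf (top_neq0 i0)) e.
rewrite [LHS](_ : _ = t (nrm t p (iter n t (top a)))); last by rewrite (nrm_morph (g := t)).
by rewrite e IH mulSn exprD rmorphM [RHS]mulrC mulrA mulrC mulrA.
Qed.

(* The twisted-algebra form of Amitsur's theorem: the only classes killed by the function
   field of the Severi-Brauer variety attached to [l] are the powers of the class of [l]. *)
Theorem amitsur a a' u m : a != 0 -> a' != 0 -> u != 0 ->
  cst L N (l ^+ m) * nrm t p a = cst L N u * nrm t p a' ->
  exists m' e, e != 0 /\ u = l ^+ m' * nrm s p e.
Proof.
have [k] := ubnP (deg a); elim: k a a' m => // k IH a a' m lek a0 a'0 u0 e.
have cst0 c : c != 0 -> cst L N c != 0 by move=> c0; rewrite -(rmorph0 (cst L N)) (inj_eq (@cst_inj _ _)).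
have lm0 n : l ^+ n != 0 by rewrite expf_neq0.
have ed : deg a = deg a'.
  have : deg (cst L N (l ^+ m) * nrm t p a) = deg (cst L N u * nrm t p a') by rewrite e.
  rewrite !degM ?cst0 ?(nrm_eq0 _ tI) // !deg_cst !deg_nrm // !add0n => /eqP.
  by rewrite eqn_pmul2l // => /eqP.
have [d0|dn0] := eqVneq (deg a) 0%N.
  have [c ec] := deg0_cst d0; have [c' ec'] := deg0_cst (etrans (esym ed) d0).
  have c0 : c != 0 by apply: contraNneq a0 => c0; rewrite ec c0 rmorph0.
  have c'0 : c' != 0 by apply: contraNneq a'0 => c0'; rewrite ec' c0' rmorph0.
  move: e; rewrite ec ec' -!(nrm_morph (f := s) _ _ (h := cst L N)) //.
  rewrite -!rmorphM => /(@cst_inj _ _) e.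
  exists m, (c / c'); split; first by rewrite mulf_neq0 ?invr_eq0.
  have n0 : nrm s p c' != 0 by apply: nrm_eq0 => //; apply: fmorph_inj.
  by apply: (mulIf n0); rewrite -e -mulrA -nrmM divfK.
(* Leading forms satisfy the same equation, so [a] and [a'] may be replaced by homogeneous
   elements. *)
have e' : cst L N (l ^+ m) * nrm t p (top a) = cst L N u * nrm t p (top a').
  by rewrite -!top_nrm -[X in X * _]top_cst -[X in _ = X * _]top_cst -!topM e.
have nu : top a \isn't a GRing.unit.
  by apply: contra dn0 => /unit_deg0; rewrite deg_top // => ->.
(* A prime factor [q] of [top a] divides the left side of [e']. As the constant [u] is a unit, [q]
   divides some conjugate of [top a']. *)
have [n fn] := factorial_itp (top_neq0 a0).
have [q pq [a1 ea1]] := factored_prime fn nu.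
have [q0 qu qP] := pq.
have dq : (0 < deg q)%N.
  rewrite lt0n; apply: contra qu => /eqP/deg0_cst[c ec].
  have c0 : c != 0 by apply: contraNneq q0 => c0; rewrite ec c0 rmorph0.
  by rewrite ec rmorph_unit // unitfE.
have [|[c ec]|/(dvdr_prod_prime pq)[i [a1' ea1']]] := qP (cst L N u) (nrm t p (top a')).
- rewrite -e' mulrC ea1 nrmM; exists (nrm t p a1 * \prod_(1 <= i < p) iter i t q * cst L N (l ^+ m)).
  rewrite !mulrA; congr (_ * _); rewrite mulrAC; congr (_ * _).
  by rewrite /nrm -(big_mkord xpredT (fun i => iter i t q)) big_ltn.
- case/negP: qu; have : cst L N u \is a GRing.unit by rewrite rmorph_unit // unitfE.
  by rewrite ec unitrM => /andP[].
have a10 : a1 != 0 by apply: contraNneq (top_neq0 a0) => z; rewrite ea1 z mulr0.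
have ia'0 : iter i t a' != 0 by elim: (val i) => //= j ij; rewrite -(rmorph0 t) (inj_eq tI).
have a1'0 : a1' != 0.
  by apply: contraNneq (top_neq0 ia'0) => z; rewrite -iter_topE ea1' z mulr0.
(* Replacing [top a'] by its [i]-th conjugate costs the factor [l^(i * deg a')], which moves to the
   left and raises the exponent; the norm of [q] then cancels on both sides. *)
apply: (IH a1 a1' (i * deg a' + m)%N) => //.
  rewrite -ltnS; apply: leq_trans lek; rewrite ltnS -(deg_top a0) ea1 degM //.
  by rewrite -[X in (X < _)%N]add0n ltn_add2r.
apply: (mulfI (nrm_eq0 p tI q0)); rewrite !(mulrCA (nrm t p q)) -!nrmM -ea1 -ea1'.
by rewrite nrm_iter_top // exprD rmorphM -mulrA e' mulrCA.
Qed.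

End Amitsur.

(** * Fraction fields and subfields *)

Lemma mk_rmorphism (R S : nzRingType) (f : R -> S) :
  zmod_morphism f -> monoid_morphism f -> exists g : {rmorphism R -> S}, g =1 f.
Proof.
move=> fz fm.
pose Hz := GRing.isZmodMorphism.Build R S f fz.
pose Hm := GRing.isMonoidMorphism.Build R S f fm.
pose g : {rmorphism R -> S} := HB.pack f Hz Hm.
by exists g.
Qed.

Section Fractions.
Local Open Scope quotient_scope.
Variable R : idomainType.
Local Notation F := {fraction R}.
Local Notation tof := (@FracField.tofrac R).

Lemma fracE (m : F) : exists a b, b != 0 /\ m = tof a / tof b.
Proof.
elim/quotW: m => q; have d0 := denom_ratioP q; exists (frac q).1, (frac q).2; split=> //.
apply: (mulIf (_ : tof (frac q).2 != 0)); first by rewrite tofrac_eq0.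
rewrite divfK ?tofrac_eq0 //.
have -> : tof (frac q).2 = \pi_F (Ratio (frac q).2 1) by rewrite /FracField.tofrac; unlock.
have -> : tof (frac q).1 = \pi_F (Ratio (frac q).1 1) by rewrite /FracField.tofrac; unlock.
rewrite -[LHS]FracField.pi_mul; apply/eqmodP; rewrite /= FracField.equivfE.
by rewrite /FracField.mulf !numden_Ratio ?mulf_neq0 ?oner_neq0 // !mulr1 mulrC.
Qed.

Lemma frac_lift (K : fieldType) (g : {rmorphism R -> K}) : injective g ->
  exists h : {rmorphism F -> K}, forall a, h (tof a) = g a.
Proof.
move=> gI.
have /choice[r rP] : forall m : F, exists ab : R * R, ab.2 != 0 /\ m = tof ab.1 / tof ab.2.
  by move=> m; have [a [b H]] := fracE m; exists (a, b).
pose f m := g (r m).1 / g (r m).2.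
have g0 b : b != 0 -> g b != 0 by move=> b0; rewrite -(rmorph0 g) (inj_eq gI).
have fE a b : b != 0 -> f (tof a / tof b) = g a / g b.
  move=> b0; have [c0 e] := rP (tof a / tof b); rewrite /f.
  set c := (r _).1 in e *; set d := (r _).2 in e c0 *.
  apply/eqP; rewrite eqr_div ?g0 // -!rmorphM (inj_eq gI) -tofrac_eq !tofracM.
  by rewrite -eqr_div ?tofrac_eq0 // -e.
have fz : zmod_morphism f.
  move=> m m'; have [a [b [b0 ->]]] := fracE m; have [c [d [d0 ->]]] := fracE m'.
  rewrite -mulNr -tofracN addf_div ?tofrac_eq0 // -!tofracM -tofracD !fE ?mulf_neq0 //.
  by rewrite -mulNr addf_div ?g0 // !(rmorphD, rmorphM, rmorphN).
have fm : monoid_morphism f.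
  split.
    have := fE 1 1 (oner_neq0 _).
    by rewrite tofrac1 rmorph1 !divr1.
  move=> m m'; have [a [b [b0 ->]]] := fracE m; have [c [d [d0 ->]]] := fracE m'.
  by rewrite mulf_div -!tofracM !fE ?mulf_neq0 // mulf_div !rmorphM.
have [h hE] := mk_rmorphism fz fm; exists h => a.
by rewrite hE -[X in f X]divr1 -tofrac1 fE ?oner_neq0 // rmorph1 divr1.
Qed.

Lemma countably_frac : countably R -> countably F.
Proof.
move=> [c cI].
have /choice[r rP] : forall m : F, exists ab : R * R, m = tof ab.1 / tof ab.2.
  by move=> m; have [a [b [_ H]]] := fracE m; exists (a, b).
exists (fun m => pickle (c (r m).1, c (r m).2)) => m m' /(pcan_inj pickleK)[/cI e1 /cI e2].
by rewrite (rP m) (rP m') e1 e2.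
Qed.

End Fractions.

Section SubFields.
Variables (F : fieldType) (P : divringClosed F).

Record subfld := SubFld { sfval : F; _ : sfval \in P }.
HB.instance Definition _ := [isSub for sfval].
HB.instance Definition _ := [Choice of subfld by <:].
HB.instance Definition _ := [SubChoice_isSubIntegralDomain of subfld by <:].
HB.instance Definition _ := [SubIntegralDomain_isSubField of subfld by <:].

Lemma subfld_lift (R : nzRingType) (g : {rmorphism R -> F}) : (forall a, g a \in P) ->
  exists h : {rmorphism R -> subfld}, forall a, val (h a) = g a.
Proof.
move=> gP; pose f a : subfld := SubFld (gP a).
have fz : zmod_morphism f by move=> a b; apply: val_inj; rewrite /= rmorphB.
have fm : monoid_morphism f.
  by split=> [|a b]; apply: val_inj; rewrite /= ?rmorph1 ?rmorphM.
by have [h hE] := mk_rmorphism fz fm; exists h => a; rewrite hE.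
Qed.

End SubFields.

Lemma divring_pred (F : fieldType) (P : F -> Prop) :
  P 1 -> (forall a b, P a -> P b -> P (a - b)) -> (forall a b, P a -> P b -> P (a / b)) ->
  exists Q : divringClosed F, forall a, a \in Q <-> P a.
Proof.
move=> P1 PB PD; pose p : {pred F} := fun a => `[< P a >].
have pP a : a \in p <-> P a by split => [/asboolP|/asboolP].
have H : divring_closed p.
  split; first exact/pP.
  - by move=> a b /pP Pa /pP Pb; apply/pP; apply: PB.
  - by move=> a b /pP Pa /pP Pb; apply/pP; apply: PD.
pose M := GRing.isDivringClosed.Build F p H.
pose Q : divringClosed F := HB.pack p M.
by exists Q.
Qed.

(** * Matrices with a cyclic vector and their commutants *)

Section Cyclic.
Variables (R : comNzRingType) (n : nat) (C : 'M[R]_n).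

(* The Krylov matrix of [x]; [kry e = 1] says that [e] is a cyclic vector in companion form. *)
Definition kry (x : 'rV[R]_n) : 'M[R]_n := \matrix_(i < n) (x *m C ^+ i).

Lemma comm_mxX B i : C *m B = B *m C -> C ^+ i *m B = B *m C ^+ i.
Proof. by move=> CB; apply/esym; apply: (@commrX 'M[R]_n B C i); apply/esym. Qed.

Lemma kryM x B : C *m B = B *m C -> kry (x *m B) = kry x *m B.
Proof.
move=> CB; apply/row_matrixP => i; rewrite rowK row_mul rowK -!mulmxA; congr (_ *m _).
by rewrite comm_mxX.
Qed.

Variable e : 'rV[R]_n.
Hypothesis cyc : kry e = 1%:M.

(** The vectors [e C^j] are the standard basis, so both sides agree on [e]; as both commute with
    [C], they agree on every [e C^k]. *)
Lemma comm_expand A : C *m A = A *m C -> A = \sum_(j < n) (e *m A) 0 j *: C ^+ j.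
Proof.
move=> CA; have CAi i := comm_mxX i CA.
apply/row_matrixP => k.
have ek i : row i (1%:M : 'M[R]_n) = e *m C ^+ i by rewrite -cyc rowK.
rewrite -[A in LHS]mul1mx row_mul ek -mulmxA CAi mulmxA.
rewrite -[X in row k X]mul1mx row_mul ek.
rewrite [X in X *m _](row_sum_delta (e *m A)) !mulmx_suml mulmx_sumr.
apply: eq_bigr => j _; rewrite -scalemxAl -scalemxAr; congr (_ *: _).
rewrite -rowE -[X in row j X]mul1mx row_mul ek -!mulmxA; congr (_ *m _).
by rewrite -[LHS]/(C ^+ j * C ^+ k) -[RHS]/(C ^+ k * C ^+ j) -!exprD addnC.
Qed.

Lemma comm_comm A B : C *m A = A *m C -> C *m B = B *m C -> A *m B = B *m A.
Proof.
move=> CA CB; rewrite (comm_expand CA) mulmx_suml mulmx_sumr; apply: eq_bigr => j _.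
rewrite -scalemxAl -scalemxAr; congr (_ *: _).
by rewrite comm_mxX.
Qed.

(** The matrix [kry x] is the polynomial in [C] that sends the cyclic vector [e] to [x]. *)
Lemma kry_comm x : C *m kry x = kry x *m C.
Proof.
apply/row_matrixP => i; rewrite !row_mul rowK -mulmxA -[C ^+ i *m C]/(C ^+ i * C) -exprSr.
have -> : row i C = e *m C ^+ i.+1.
  rewrite -[C in LHS]mul1mx -cyc row_mul rowK -mulmxA -[C ^+ i *m C]/(C ^+ i * C).
  by rewrite -exprSr.
have /comm_expand h : C *m C ^+ i.+1 = C ^+ i.+1 *m C by rewrite comm_mxX.
rewrite [in RHS]h mulmx_sumr [LHS]mulmx_sum_row; apply: eq_bigr => j _.
by rewrite rowK -scalemxAr.
Qed.

End Cyclic.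

Lemma map_kry (A B : comNzRingType) (h : {rmorphism A -> B}) m (D : 'M[A]_m) x :
  map_mx h (kry D x) = kry (map_mx h D) (map_mx h x).
Proof.
apply/row_matrixP => i; rewrite -map_row !rowK map_mxM; congr (_ *m _).
elim: (val i) => [|k IH]; first by rewrite !expr0 map_mx1.
by rewrite !exprS -!mulmxE map_mxM IH.
Qed.

(** * Generic extension of a cyclic pair *)

(* The fixed field [K] of [sg] contains [zt], and [car] is the Kummer extension [K(xx)]; the norm
   [nrm sg p] is that of [car / K], so [bb_indep] says that the cyclic algebras of the [bb i] are
   independent in the [p]-torsion of the Brauer group of [K]. *)
Record sfield (p : nat) := SField {
  car :> fieldType;
  sg : {rmorphism car -> car};
  zt : car;
  xx : car;
  bb : nat -> car;
  sg_p : forall a, iter p sg a = a;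
  zt_prim : p.-primitive_root zt;
  sg_zt : sg zt = zt;
  xx_neq0 : xx != 0;
  sg_xx : sg xx = zt * xx;
  bb_neq0 : forall i, bb i != 0;
  sg_bb : forall i, sg (bb i) = bb i;
  bb_indep : forall N (e : nat -> nat) m,
    \prod_(i < N) bb i ^+ e i = nrm sg p m -> forall i, (i < N)%N -> (p %| e i)%N }.

Definition smor p (S S' : sfield p) (f : S -> S') :=
  [/\ forall a, f (sg S a) = sg S' (f a), f (zt S) = zt S', f (xx S) = xx S' &
      forall i, f (bb S i) = bb S' i].

Definition mxnrm (R : nzRingType) (f : R -> R) (p n : nat) (A : 'M[R]_n) : 'M[R]_n :=
  \prod_(i < p) map_mx (iter i f) A.

Lemma iter_map_mx (R : Type) (f : R -> R) m n k (A : 'M[R]_(m, n)) :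
  iter k (map_mx f) A = map_mx (iter k f) A.
Proof.
elim: k => [|k IH] /=; first by apply/matrixP => i j; rewrite mxE.
by rewrite IH -map_mx_comp; apply/matrixP => i j; rewrite !mxE.
Qed.

Lemma prod_mulm_l (R : nzRingType) n k (F : nat -> 'M[R]_n) :
  \prod_(i < k.+1) F i = F 0%N *m \prod_(i < k) F i.+1.
Proof. by rewrite big_ord_recl. Qed.

Lemma bb_prod_mul p (S : sfield p) M (f : nat -> nat) a k : (a < M)%N ->
  (\prod_(i < M) bb S i ^+ f i) * bb S a ^+ k = \prod_(i < M) bb S i ^+ (f i + (i == a :> nat) * k).
Proof.
move=> ltaM; rewrite (bigD1 (Ordinal ltaM)) //= [RHS](bigD1 (Ordinal ltaM)) //= eqxx mul1n exprD.
rewrite mulrAC; congr (_ * _); apply: eq_bigr => i; rewrite -val_eqE /= => /negbTE ->.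
by rewrite mul0n addn0.
Qed.

(** Exponents are natural numbers, so a factor [b^m] is removed by multiplying by [b^(m * p.-1)]:
    the [p]-th power of a fixed element is a norm. *)
Lemma nrm_absorb p (S : sfield p) b m c : (0 < p)%N -> sg S b = b ->
  b ^+ m * nrm (sg S) p c * b ^+ (m * p.-1) = nrm (sg S) p (b ^+ m * c).
Proof.
move=> p0 sb; rewrite nrmM nrmX (nrm_fix p sb) mulrAC -exprD -mulnS prednK //.
by rewrite -exprM mulnC.
Qed.

(** The first relation changes only the exponent at [j0], so [p] divides all the others. The second
    changes those at [i0] and [j0] by the same amount; at [i0] this amount is seen to be a multiple
    of [p], which settles [j0]. *)
Lemma bb_indep_step p (S : sfield p) i0 j0 M (f : nat -> nat) : (0 < p)%N -> i0 <> j0 ->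
  let u := \prod_(i < M) bb S i ^+ f i in
  (exists m c, u = bb S j0 ^+ m * nrm (sg S) p c) ->
  (exists m c, u = (bb S j0 * bb S i0) ^+ m * nrm (sg S) p c) ->
  forall i, (i < M)%N -> (p %| f i)%N.
Proof.
move=> p0 ij u [m [c e1]] [m' [c' e2]].
(* The range is enlarged, with zero exponents, so as to contain [i0] and [j0]. *)
pose M' := (M + (i0 + j0).+1)%N; pose f' i := if (i < M)%N then f i else 0%N.
have i0M : (i0 < M')%N by rewrite /M'; lia.
have j0M : (j0 < M')%N by rewrite /M'; lia.
have eu : u = \prod_(i < M') bb S i ^+ f' i.
  rewrite /u (big_ord_widen M' (fun i => bb S i ^+ f i)) ?leq_addr // big_mkcond /=.
  by apply: eq_bigr => i _; rewrite /f'; case: ifP.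
have H1 i : (i < M')%N -> (p %| f' i + (i == j0) * (m * p.-1))%N.
  move=> lti; have := @bb_indep p S M' (fun i => f' i + (i == j0) * (m * p.-1))%N _ _ i lti.
  by apply; rewrite -bb_prod_mul // -eu e1 nrm_absorb // sg_bb.
have H2 i : (i < M')%N -> (p %| (f' i + (i == j0) * (m' * p.-1)) + (i == i0) * (m' * p.-1))%N.
  move=> lti; have := @bb_indep p S M'
    (fun i => (f' i + (i == j0) * (m' * p.-1)) + (i == i0) * (m' * p.-1))%N _ _ i lti.
  apply; rewrite -(bb_prod_mul S (fun i => f' i + (i == j0) * (m' * p.-1))%N) // -bb_prod_mul //.
  by rewrite -eu -mulrA -exprMn e2 nrm_absorb // rmorphM /= !sg_bb.
have ij' : (i0 == j0) = false by apply/eqP.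
have ji' : (j0 == i0) = false by rewrite eq_sym.
have di : (p %| f' i0)%N by have := H1 _ i0M; rewrite ij' mul0n addn0.
have dm : (p %| m' * p.-1)%N.
  by have := H2 _ i0M; rewrite ij' eqxx mul0n mul1n addn0 dvdn_addr.
have dj : (p %| f' j0)%N.
  by have := H2 _ j0M; rewrite ji' eqxx mul0n mul1n addn0 dvdn_addl.
move=> i lti; have -> : f i = f' i by rewrite /f' lti.
have [->//|ni] := eqVneq i j0.
by have := H1 i (leq_trans lti (leq_addr _ _)); rewrite (negbTE ni) mul0n addn0.
Qed.

Section Step.
Variables (p : nat) (S : sfield p) (n' : nat).
Hypothesis p_gt0 : (0 < p)%N.
Let n := n'.+1.
Variables (C H : 'M[S]_n) (e : 'rV[S]_n) (i0 j0 : nat).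
Hypothesis ij : i0 <> j0.
Hypothesis sC : map_mx (sg S) C = C.
Hypothesis CH : C *m H = H *m C.
Hypothesis cyc : kry C e = 1%:M.
Let v := bb S i0.
Let w := bb S j0.
Hypothesis Hv : mxnrm (sg S) p H = v%:M.

Let N := (p * n)%N.
Let R := itp S N.
Let cs : {rmorphism S -> R} := cst S N.

(* The rows [gpt 0, ..., gpt p.-1] are made of the [p * n] variables, and [gpt (k + p) = w gpt k].
   Both [t1 : gpt k |-> gpt k.+1] and [t2 : gpt k |-> gpt k.+1 *m H] are semilinear; their [p]-th
   powers multiply the variables by [w] and by [w * v]. *)
Definition gco (k j : nat) : R := cs (w ^+ (k %/ p)) * var S N (k %% p * n + j).
Definition gpt k : 'rV[R]_n := \row_j gco k j.
Let cH := map_mx cs H.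

Let g : {rmorphism S -> R} := [the {rmorphism S -> R} of cs \o sg S].
Definition t1 : {rmorphism R -> R} := evl g (fun i => gco (i %/ n).+1 (i %% n)) N.
Definition t2 : {rmorphism R -> R} :=
  evl g (fun i => (gpt (i %/ n).+1 *m cH) 0 (inord (i %% n))) N.

Lemma gco_shift m r j : gco (m * p + r) j = cs (w ^+ m) * gco r j.
Proof. by rewrite /gco divnMDl // modnMDl exprD rmorphM mulrA. Qed.

Lemma gpt_shift m r : gpt (m * p + r) = cs (w ^+ m) *: gpt r.
Proof. by apply/rowP => j; rewrite !mxE gco_shift. Qed.

Lemma gpt_p k : gpt (k + p) = cs w *: gpt k.
Proof. by rewrite addnC -{1}(mul1n p) gpt_shift expr1. Qed.

Lemma var_lt k (j : 'I_n) : (k %% p * n + j < N)%N.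
Proof.
apply: (@leq_trans ((k %% p).+1 * n)); first by rewrite mulSn addnC ltn_add2r.
by rewrite leq_mul2r ltn_mod p_gt0 orbT.
Qed.

Lemma t1_cs c : t1 (cs c) = cs (sg S c). Proof. exact: evl_cst. Qed.
Lemma t2_cs c : t2 (cs c) = cs (sg S c). Proof. exact: evl_cst. Qed.

Lemma gpt_succ k : gpt k.+1 = cs (w ^+ (k %/ p)) *: gpt (k %% p).+1.
Proof. by rewrite -gpt_shift addnS -divn_eq. Qed.

Lemma t1_X k : map_mx t1 (gpt k) = gpt k.+1.
Proof.
rewrite gpt_succ; apply/rowP => j; rewrite !mxE rmorphM /= t1_cs rmorphXn /= sg_bb.
by rewrite evl_var ?var_lt // divnMDl // modnMDl (divn_small (ltn_ord j)) (modn_small (ltn_ord j)) addn0.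
Qed.

Lemma t2_X k : map_mx t2 (gpt k) = gpt k.+1 *m cH.
Proof.
rewrite gpt_succ -scalemxAl; apply/rowP => j; rewrite !mxE rmorphM /= t2_cs rmorphXn /= sg_bb.
rewrite evl_var ?var_lt // divnMDl // modnMDl (divn_small (ltn_ord j)) (modn_small (ltn_ord j)) addn0.
by rewrite inord_val mxE.
Qed.

Definition Hn k : 'M[S]_n := \prod_(i < k) map_mx (iter i (sg S)) H.

Lemma HnS k : Hn k.+1 = H *m map_mx (sg S) (Hn k).
Proof.
rewrite /Hn (prod_mulm_l k (fun i => map_mx (iter i (sg S)) H)) map_mx_id //; congr (_ *m _).
elim: k => [|k IH]; first by rewrite !big_ord0 map_mx1.
by rewrite !big_ord_recr /= IH map_mxM -map_mx_comp.
Qed.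

Lemma iter_t1_X k m : iter m (map_mx t1) (gpt k) = gpt (k + m).
Proof. by elim: m => [|m IH]; rewrite ?addn0 // addnS /= IH t1_X. Qed.

Lemma map_t2_cs m1 m2 (A : 'M[S]_(m1, m2)) : map_mx t2 (map_mx cs A) = map_mx cs (map_mx (sg S) A).
Proof. by apply/matrixP => i j; rewrite !mxE t2_cs. Qed.

Lemma iter_t2_X k m : iter m (map_mx t2) (gpt k) = gpt (k + m) *m map_mx cs (Hn m).
Proof.
elim: m => [|m IH]; first by rewrite addn0 /Hn big_ord0 map_mx1 mulmx1.
by rewrite /= IH map_mxM t2_X map_t2_cs -mulmxA -map_mxM -HnS addnS.
Qed.

Lemma var_X i : (i < N)%N -> var S N i = gpt (i %/ n) 0 (inord (i %% n)).
Proof.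
move=> lti; rewrite mxE /gco inordK ?ltn_mod //.
have h : (i %/ n < p)%N by rewrite ltn_divLR.
by rewrite divn_small // expr0 rmorph1 mul1r modn_small // -divn_eq.
Qed.

Lemma iter_t1_var i : (i < N)%N -> iter p t1 (var S N i) = cs w * var S N i.
Proof.
move=> lti; rewrite var_X //.
have -> u j : iter p t1 (gpt u 0 j) = iter p (map_mx t1) (gpt u) 0 j by rewrite iter_map_mx [RHS]mxE.
by rewrite iter_t1_X gpt_p mxE.
Qed.

Lemma iter_t2_var i : (i < N)%N -> iter p t2 (var S N i) = cs (w * v) * var S N i.
Proof.
move=> lti; rewrite var_X //.
have -> u j : iter p t2 (gpt u 0 j) = iter p (map_mx t2) (gpt u) 0 j by rewrite iter_map_mx [RHS]mxE.
rewrite iter_t2_X gpt_p /Hn -/(mxnrm _ _ _) Hv map_scalar_mx mul_mx_scalar scalerA.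
by rewrite [LHS]mxE -rmorphM (mulrC v).
Qed.

Local Notation gr := (@grad S N).

Lemma grad_X k j : gr (gpt k 0 j) = gpt k 0 j *: 'X :> {poly R}.
Proof.
rewrite mxE /gco rmorphM /= evl_cst /= evl_var ?var_lt //.
by rewrite mul_polyC scalerA.
Qed.

Lemma grad_cs c : gr (cs c) = (cs c)%:P.
Proof. exact: evl_cst. Qed.

Lemma grad_var i : (i < N)%N -> gr (var S N i) = var S N i *: 'X :> {poly R}.
Proof. by move=> lti; rewrite evl_var. Qed.

Lemma grad_t1 i : (i < N)%N -> gr (t1 (var S N i)) = map_poly t1 (gr (var S N i)).
Proof.
move=> lti; rewrite grad_var // map_polyZ map_polyX /= var_X //.
have -> u j : t1 (gpt u 0 j) = map_mx t1 (gpt u) 0 j by rewrite [RHS]mxE.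
by rewrite t1_X grad_X.
Qed.

Lemma grad_t2 i : (i < N)%N -> gr (t2 (var S N i)) = map_poly t2 (gr (var S N i)).
Proof.
move=> lti; rewrite grad_var // map_polyZ map_polyX /= var_X //.
have -> u j : t2 (gpt u 0 j) = map_mx t2 (gpt u) 0 j by rewrite [RHS]mxE.
rewrite t2_X mxE rmorph_sum scaler_suml; apply: eq_bigr => k _.
rewrite rmorphM grad_X [cH _ _]mxE grad_cs -scalerAl.
by rewrite ['X * _]mulrC mul_polyC scalerA.
Qed.

(** The [p]-th iterate of [t] only rescales the variables by [l], and is undone by rescaling them by
    the inverse of [l]. *)
Lemma semilinear_inj (t : {rmorphism R -> R}) (l : S) : l != 0 ->
  (forall c, t (cs c) = cs (sg S c)) ->
  (forall i, (i < N)%N -> iter p t (var S N i) = cs l * var S N i) -> injective t.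
Proof.
move=> l0 tc tv.
have itc k c : iter k t (cs c) = cs (iter k (sg S) c) by elim: k => //= k ->; rewrite tc.
pose r := evl cs (fun i => cs l^-1 * var S N i) N.
suff H1 : cancel (iter p t) r.
  have I : injective (iter p t) by apply: can_inj H1.
  by move=> a b tab; apply: I; rewrite -(prednK p_gt0) !iterSr tab.
move=> a; rewrite -itermE.
apply: (itp_ext (f1 := [the {rmorphism R -> R} of r \o iterm t p])
  (f2 := [the {rmorphism R -> R} of idfun])) => [c|i lti] /=; rewrite itermE.
  by rewrite itc sg_p /r evl_cst.
by rewrite tv // rmorphM /r evl_cst evl_var // mulrA -rmorphM divff // rmorph1 mul1r.
Qed.

Lemma t1_inj : injective t1.
Proof. exact: (semilinear_inj (bb_neq0 S j0) t1_cs iter_t1_var). Qed.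
Lemma t2_inj : injective t2.
Proof.
exact: (semilinear_inj (mulf_neq0 (bb_neq0 S j0) (bb_neq0 S i0)) t2_cs iter_t2_var).
Qed.

(** Amitsur's theorem is applied twice to the same [a] and [a'], starting from exponent 0: with
    [l = w] for [t1], and with [l = w * v] for [t2]. *)
Lemma t_norms a a' u : a != 0 -> a' != 0 -> u != 0 ->
  nrm t1 p a = cs u * nrm t1 p a' -> nrm t2 p a = cs u * nrm t2 p a' ->
  (exists m c, u = w ^+ m * nrm (sg S) p c) /\
  (exists m c, u = (w * v) ^+ m * nrm (sg S) p c).
Proof.
move=> a0 a'0 u0 e1 e2.
have z0 l : cs (l ^+ 0) = 1 by rewrite expr0 rmorph1.
split.
- have [|m [c [_ ec]]] := @amitsur S (sg S) p N p_gt0 (@sg_p _ S) t1 w (bb_neq0 S j0) t1_cs t1_inj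
    grad_t1 iter_t1_var a a' u 0 a0 a'0 u0; first by rewrite z0 mul1r.
  by exists m, c.
- have [|m [c [_ ec]]] := @amitsur S (sg S) p N p_gt0 (@sg_p _ S) t2 (w * v)
    (mulf_neq0 (bb_neq0 S j0) (bb_neq0 S i0)) t2_cs t2_inj
    grad_t2 iter_t2_var a a' u 0 a0 a'0 u0; first by rewrite z0 mul1r.
  by exists m, c.
Qed.

Variables (F : fieldType) (tof : {rmorphism R -> F}) (T1 T2 : {rmorphism F -> F}).
Hypothesis tof_inj : injective tof.
Hypothesis HT1 : forall a, T1 (tof a) = tof (t1 a).
Hypothesis HT2 : forall a, T2 (tof a) = tof (t2 a).
Hypothesis tof_frac : forall m, exists a b, b != 0 /\ m = tof a / tof b.
Hypothesis cF_count : countably F.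

Lemma tof_neq0 a : a != 0 -> tof a != 0.
Proof. by move=> a0; rewrite -(rmorph0 tof) (inj_eq tof_inj). Qed.

Definition cF : {rmorphism S -> F} := [the {rmorphism S -> F} of tof \o cs].

Let Cc := map_mx cs C.
Let CF := map_mx cF C.

(** The generic element of the commutative algebra generated by [C]: its coordinates on the powers
    of [C] are the entries of [gpt k]. *)
Definition Ps k : 'M[F]_n := kry CF (map_mx tof (gpt k)).

Lemma Ps_p k : Ps (k + p) = cF w *: Ps k.
Proof.
rewrite /Ps gpt_p; apply/row_matrixP => i; rewrite linearZ /= !rowK scalemxAl; congr (_ *m _).
by apply/rowP => j; rewrite !mxE rmorphM.
Qed.

Lemma cycF : kry CF (map_mx cF e) = 1%:M.
Proof. by rewrite -map_kry cyc map_mx1. Qed.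

(** Specializing the variables of [gpt 0] to the entries of the cyclic vector turns the Krylov
    matrix into the identity, so its determinant is a nonzero polynomial. *)
Lemma Ps0_unit : Ps 0 \in unitmx.
Proof.
pose sp := evl [the {rmorphism S -> S} of idfun] (fun i => e 0 (inord i)) N.
have spX : map_mx sp (gpt 0) = e.
  apply/rowP => j; rewrite !mxE rmorphM /= !(div0n, mod0n, mul0n, add0n) expr0 rmorph1 rmorph1 mul1r.
  rewrite evl_var ?inord_val //.
  by rewrite (leq_trans (ltn_ord j)) // leq_pmull.
have spC : map_mx sp Cc = C by apply/matrixP => i j; rewrite !mxE /= evl_cst.
have : sp (\det (kry Cc (gpt 0))) = 1.
  by rewrite -det_map_mx map_kry spX spC cyc det1.
move=> d1; have d0 : \det (kry Cc (gpt 0)) != 0.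
  by apply/eqP => z; move/eqP: d1; rewrite z rmorph0 eq_sym oner_eq0.
have CFE : CF = map_mx tof Cc by apply/matrixP => i j; rewrite !mxE.
have -> : Ps 0 = map_mx tof (kry Cc (gpt 0)) by rewrite /Ps CFE map_kry.
by rewrite unitmxE det_map_mx unitfE tof_neq0.
Qed.

(* The new field is the part of [F] fixed by [T1 ^ p] on which [T1] and [T2] agree.  It contains the
   entries of [Z = (Ps 0)^-1 * Ps 1]: [T2 ^ k] maps [Ps 0] and [Ps 1] to [Ps k] and [Ps k.+1] times the
   same matrix [Hn k], which commutes with them. *)
Theorem step_ext_frac : exists (S' : sfield p) (f : {rmorphism S -> S'}),
  [/\ countably S', smor f & exists Z : 'M[S']_n,
    map_mx f C *m Z = Z *m map_mx f C /\ mxnrm (sg S') p Z = (bb S' j0)%:M].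
Proof.
have T1c a : T1 (cF a) = cF (sg S a) by rewrite /= HT1 t1_cs.
have T2c a : T2 (cF a) = cF (sg S a) by rewrite /= HT2 t2_cs.
have iTc (T : {rmorphism F -> F}) : (forall a, T (cF a) = cF (sg S a)) ->
    forall k a, iter k T (cF a) = cF (iter k (sg S) a).
  by move=> HT k a; elim: k => // k IH; rewrite !iterS IH HT.
(* Agreement is asked of all iterates: the equality of [T1 m] and [T2 m] alone would not be
   inherited by [T1 m]. *)
pose PP (m : F) := (forall i, iter i T1 m = iter i T2 m) /\
  (forall i, iter (i + p) T1 m = iter i T1 m).
have PB a b : PP a -> PP b -> PP (a - b).
  move=> [a1 a2] [b1 b2]; split=> i; rewrite -!itermE !rmorphB !itermE.
    by rewrite a1 b1.
  by rewrite a2 b2.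
have PD a b : PP a -> PP b -> PP (a / b).
  move=> [a1 a2] [b1 b2]; split=> i; rewrite -!itermE !rmorphM !fmorphV !itermE.
    by rewrite a1 b1.
  by rewrite a2 b2.
have Pc a : PP (cF a).
  split=> i; rewrite !iTc //.
  by congr (cF _); rewrite iterD sg_p.
have P1 : PP 1 by rewrite -(rmorph1 cF).
have [Q HQ] := divring_pred P1 PB PD.
pose L' : fieldType := subfld Q.
have sgP (a : L') : (T1 \o val) a \in Q.
  have /HQ[a1 a2] := valP a; apply/HQ; split=> i.
    have e1 : T1 (val a) = T2 (val a) := a1 1%N.
    by rewrite /= {2}e1 -!iterSr a1.
  by rewrite /= -!iterSr -addSn a2.
have [s' hs'] := subfld_lift (g := [the {rmorphism L' -> F} of T1 \o val]) sgP.
have [f hf] := subfld_lift (g := cF) (fun a => (HQ (cF a)).2 (Pc a)).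
have its' k a : val (iter k s' a) = iter k T1 (val a) by elim: k => //= k IH; rewrite hs' /= IH.
have fs a : f (sg S a) = s' (f a) by apply: val_inj; rewrite hs' /= !hf T1c.
have s'p a : iter p s' a = a.
  by apply: val_inj; rewrite its'; have /HQ[_ /(_ 0%N)] := valP a; rewrite add0n.
have s'fix a : sg S a = a -> s' (f a) = f a by move=> sa; rewrite -fs sa.
have f0 a : a != 0 -> f a != 0 by rewrite fmorph_eq0.
have s'xx : s' (f (xx S)) = f (zt S) * f (xx S) by rewrite -fs sg_xx rmorphM.
have zp : p.-primitive_root (f (zt S)) by rewrite fmorph_primitive_root zt_prim.
have ind M (ex : nat -> nat) m : \prod_(i < M) f (bb S i) ^+ ex i = nrm s' p m ->
    forall i, (i < M)%N -> (p %| ex i)%N.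
  pose u := \prod_(i < M) bb S i ^+ ex i.
  have u0 : u != 0 by apply/prodf_neq0 => i _; rewrite expf_neq0 ?bb_neq0.
  move=> em; have em' : cF u = nrm T1 p (val m).
    have -> : nrm T1 p (val m) = val (nrm s' p m).
      by rewrite (nrm_morph (h := [the {rmorphism L' -> F} of val]) (g := T1)).
    rewrite -em -hf.
    by congr val; rewrite rmorph_prod; apply: eq_bigr => i _; rewrite rmorphXn.
  (* A norm from the new field is computed equally by [T1] and [T2]. Clearing the denominator of [m]
     yields the two polynomial identities that [t_norms] requires, with the same [a] and [b]. *)
  have em2 : nrm T1 p (val m) = nrm T2 p (val m).
    by apply: eq_bigr => i _; have /HQ[a1 _] := valP m; rewrite a1.
  have [a [b [b0 ab]]] := tof_frac (val m).
  have a0 : a != 0.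
    apply/eqP => a0; move/eqP: em'; rewrite ab a0 rmorph0 mul0r.
    have -> : nrm T1 p 0 = 0 by rewrite /nrm -(prednK p_gt0) big_ord_recl /= mul0r.
    by rewrite fmorph_eq0 (negbTE u0).
  have nab (t : {rmorphism R -> R}) (T : {rmorphism F -> F}) : (forall a, T (tof a) = tof (t a)) ->
      injective t -> cF u = nrm T p (val m) -> nrm t p a = cs u * nrm t p b.
    move=> HT tI eu; apply: tof_inj; rewrite rmorphM -[tof (cs u)]/(cF u) eu.
    have tn c : tof (nrm t p c) = nrm T p (tof c).
      by apply: nrm_morph => c'; rewrite HT.
    by rewrite !tn -nrmM ab divfK // tof_neq0.
  have [|h1 h2] := t_norms a0 b0 u0 (nab _ _ HT1 t1_inj em').
    by apply: (nab _ _ HT2 t2_inj); rewrite -em2.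
  exact: (bb_indep_step p_gt0 ij h1 h2).
pose S' : sfield p := @SField p L' s' (f (zt S)) (f (xx S)) (fun i => f (bb S i)) s'p zp
  (s'fix _ (sg_zt S)) (f0 _ (xx_neq0 S)) s'xx (fun i => f0 _ (bb_neq0 S i))
  (fun i => s'fix _ (sg_bb S i)) ind.
exists S', f; split=> //.
  have [c cI] := cF_count; by exists (fun a : L' => c (val a)) => a b /cI/val_inj.
have CFfix (T : {rmorphism F -> F}) : (forall a, T (cF a) = cF (sg S a)) -> map_mx T CF = CF.
  move=> HT; transitivity (map_mx cF (map_mx (sg S) C)); last by rewrite sC.
  by apply/matrixP => i j; rewrite !mxE HT.
have T1Ps k : map_mx T1 (Ps k) = Ps k.+1.
  rewrite /Ps map_kry CFfix //; apply: (f_equal (@kry F n CF)); rewrite -t1_X.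
  by apply/matrixP => i j; rewrite !mxE HT1.
have iT1Ps m k : map_mx (iterm T1 m) (Ps k) = Ps (k + m).
  elim: m => [|m IH]; first by rewrite addn0; apply/matrixP => i j; rewrite mxE.
  rewrite addnS -T1Ps -IH; by apply/matrixP => i j; rewrite !mxE.
have CHn k : C *m Hn k = Hn k *m C.
  elim: k => [|k IH]; first by rewrite /Hn big_ord0 mulmx1 mul1mx.
  by rewrite HnS mulmxA CH -!mulmxA -{1}sC -map_mxM IH map_mxM sC.
have iT2Ps m k : map_mx (iterm T2 m) (Ps k) = Ps (k + m) *m map_mx cF (Hn m).
  have -> : map_mx (iterm T2 m) (Ps k) =
      kry CF (map_mx tof (iter m (map_mx t2) (gpt k))).
    rewrite /Ps map_kry; apply: (f_equal2 (@kry F n)).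
      elim: (m) => [|j IH]; first by apply/matrixP => x y; rewrite mxE.
      transitivity (map_mx T2 (map_mx (iterm T2 j) CF)); last by rewrite IH CFfix.
      by apply/matrixP => x y; rewrite ![LHS]mxE [RHS]mxE [X in T2 X]mxE.
    by rewrite iter_map_mx; apply/matrixP => x y; rewrite !mxE itermE (iter_morph _ _ HT2).
  rewrite iter_t2_X map_mxM -kryM; last by rewrite -!map_mxM CHn.
  by apply: (f_equal (@kry F n CF)); congr (_ *m _); apply/matrixP => x y; rewrite !mxE.
have PsU k : Ps k \in unitmx by rewrite -(add0n k) -iT1Ps map_unitmx Ps0_unit.
have HnU k : map_mx cF (Hn k) \in unitmx.
  have U : map_mx (iterm T2 k) (Ps 0) \in unitmx by rewrite map_unitmx Ps0_unit.
  by move: U; rewrite iT2Ps unitmx_mul => /andP[].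
have PsC k : CF *m Ps k = Ps k *m CF := kry_comm cycF _.
have PsH k m : Ps k *m map_mx cF (Hn m) = map_mx cF (Hn m) *m Ps k.
  by apply: (comm_comm cycF); rewrite ?PsC // -!map_mxM CHn.
pose z := invmx (Ps 0) *m Ps 1.
have zC : CF *m z = z *m CF.
  apply: (can_inj (mulKmx (PsU 0))); rewrite !mulmxA mulmxV // mul1mx -PsC -!mulmxA.
  by rewrite (mulmxA (Ps 0)) mulmxV // mul1mx.
have iT1z m : map_mx (iterm T1 m) z = invmx (Ps m) *m Ps m.+1.
  by rewrite map_mxM map_invmx !iT1Ps add0n add1n.
have zP i j : z i j \in Q.
  apply/HQ; split=> k.
    suff : map_mx (iterm T1 k) z = map_mx (iterm T2 k) z.
      by move/matrixP/(_ i j); rewrite !mxE !itermE.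
    rewrite iT1z map_mxM map_invmx !iT2Ps add0n add1n.
    have -> : Ps k.+1 *m map_mx cF (Hn k) = (Ps k *m map_mx cF (Hn k)) *m (invmx (Ps k) *m Ps k.+1).
      by rewrite (PsH k) -mulmxA mulKVmx // PsH.
    by rewrite mulKmx // unitmx_mul PsU HnU.
  suff : map_mx (iterm T1 (k + p)) z = map_mx (iterm T1 k) z.
    by move/matrixP/(_ i j); rewrite !mxE !itermE.
  rewrite !iT1z -addSn !Ps_p invmxZ; last first.
    by rewrite unitmxZ ?PsU // unitfE fmorph_eq0 bb_neq0.
  by rewrite -scalemxAl -scalemxAr scalerA mulVf ?scale1r // fmorph_eq0 bb_neq0.
pose Z : 'M[S']_n := \matrix_(i, j) (SubFld (zP i j) : L').
pose vl := [the {rmorphism L' -> F} of val].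
have vZ : map_mx vl Z = z by apply/matrixP => i j; rewrite !mxE.
have vC : map_mx vl (map_mx f C) = CF by apply/matrixP => i j; rewrite !mxE [LHS]hf.
have vI : injective (@map_mx _ _ vl n n) by apply: map_mx_inj; exact: val_inj.
exists Z; split; apply: vI.
  by rewrite !map_mxM vC vZ.
have -> : map_mx vl ((bb S' j0)%:M : 'M[S']_n) = (cF w)%:M.
  by rewrite map_scalar_mx /= hf.
(* The [k]-th conjugate of [Z] is the inverse of [Ps k] times [Ps k.+1], so the twisted norm
   telescopes; it ends at [Ps p], which is [w] times [Ps 0]. *)
suff Hm m : map_mx vl (\prod_(i < m) map_mx (iter i s') Z) = invmx (Ps 0) *m Ps m.
  by rewrite [LHS]Hm (Ps_p 0) -scalemxAr mulVmx // scalemx1.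
elim: m => [|m IH]; first by rewrite big_ord0 map_mx1 mulVmx.
have -> : map_mx vl (\prod_(i < m.+1) map_mx (iter i s') Z) =
   map_mx vl (\prod_(i < m) map_mx (iter i s') Z) *m map_mx vl (map_mx (iter m s') Z).
  by rewrite -map_mxM big_ord_recr.
have -> : map_mx vl (map_mx (iter m s') Z) = map_mx (iterm T1 m) z.
  rewrite -vZ; apply/matrixP => i j.
  rewrite [LHS]mxE [map_mx _ Z i j]mxE [RHS]mxE [map_mx vl Z i j]mxE itermE; exact: its'.
by rewrite IH iT1z -mulmxA mulKVmx.
Qed.

End Step.

Theorem step_ext (p : nat) (S : sfield p) (q : nat) (C H : 'M[S]_q.+1) (e : 'rV[S]_q.+1)
    (i0 j0 : nat) : (0 < p)%N -> i0 <> j0 -> map_mx (sg S) C = C -> C *m H = H *m C ->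
  kry C e = 1%:M -> mxnrm (sg S) p H = (bb S i0)%:M -> countably S ->
  exists (S' : sfield p) (f : {rmorphism S -> S'}),
  [/\ countably S', smor f & exists Z : 'M[S']_q.+1,
    map_mx f C *m Z = Z *m map_mx f C /\ mxnrm (sg S') p Z = (bb S' j0)%:M].
Proof.
move=> p0 ij sC CH cyc Hv cS; set R := itp S (p * q.+1).
pose tof := [the {rmorphism R -> {fraction R}} of @FracField.tofrac R].
have tI : injective tof by move=> a b /eqP; rewrite /= tofrac_eq => /eqP.
have ext (t : {rmorphism R -> R}) : injective t ->
    exists T : {rmorphism {fraction R} -> {fraction R}}, forall a, T (tof a) = tof (t a).
  move=> hI; pose h := [the {rmorphism R -> {fraction R}} of tof \o t].
  have hI' : injective h by move=> a b /tI/hI.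
  by have [T HT] := frac_lift hI'; exists T.
have [T1 HT1] := ext (t1 S q j0) (@t1_inj p S q p0 j0).
have [T2 HT2] := ext (t2 H j0) (@t2_inj p S q p0 H i0 j0 Hv).
have cF : countably {fraction R} by apply: countably_frac; apply: countably_itp.
exact: (step_ext_frac p0 ij sC CH cyc Hv tI HT1 HT2 (@fracE R) cF).
Qed.

(** * A cyclic pair to start from *)

Lemma frac_aut (R : idomainType) (s : {rmorphism R -> R}) p : (0 < p)%N ->
  (forall a, iter p s a = a) -> exists T : {rmorphism {fraction R} -> {fraction R}},
    (forall a, T (FracField.tofrac a) = FracField.tofrac (s a)) /\ (forall a, iter p T a = a).
Proof.
move=> p0 sp; set tof := @FracField.tofrac R.
have tI : injective tof by move=> a b /eqP; rewrite tofrac_eq => /eqP.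
have sI : injective s.
  by move=> a b e; rewrite -[a]sp -[b]sp -(prednK p0) !iterSr e.
pose h := [the {rmorphism R -> {fraction R}} of tof \o s].
have hI : injective h by move=> a b /tI/sI.
have [T HT] := frac_lift hI; exists T; split=> // m.
have [a [b [_ ->]]] := fracE m.
by rewrite -itermE rmorphM fmorphV !itermE !(iter_morph (f := s) (h := tof)) // !sp.
Qed.

(** As [s] fixes [c], all conjugates of [a] have the same multiplicity at [c]. *)
Lemma mup_nrm (Q : fieldType) (s : {rmorphism Q -> Q}) p c (a : {poly Q}) :
  s c = c -> a != 0 -> mup c (nrm (map_poly s) p a) = (p * mup c a)%N.
Proof.
move=> sc a0; rewrite /nrm.
have ms b : b != 0 -> mup c (map_poly s b) = mup c b.
  move=> b0; have [m] := multiplicity_XsubC b c; rewrite b0 /= => -[q rq ->].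
  have c0 : ('X - c%:P) ^+ m != 0 by rewrite expf_neq0 // polyXsubC_eq0.
  have sX : map_poly s (('X - c%:P) ^+ m) = ('X - c%:P) ^+ m.
    by rewrite rmorphXn /= rmorphB /= map_polyX map_polyC /= sc.
  rewrite rmorphM /= sX mupMr; first by rewrite mupMr.
  by rewrite -sc fmorph_root.
elim: p => [|n IH]; first by rewrite big_ord0 mupNroot // root1.
have i0 k : iter k (map_poly s) a != 0 by elim: k => //= k; rewrite map_poly_eq0.
rewrite big_ord_recr mupM ?IH ?mulSnr //; last by apply/prodf_neq0 => i _.
by congr (_ + _)%N; elim: (n) => //= k <-; rewrite ms.
Qed.

(* The [b_i] are the polynomials [X - i] over [Q]; the multiplicity of the root [i] in a norm is a
   multiple of [p]. *)
Lemma poly_sfield p (Q : fieldType) (s2 : {rmorphism Q -> Q}) (z x : Q) : (0 < p)%N ->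
  (forall a, iter p s2 a = a) -> p.-primitive_root z -> s2 z = z -> x != 0 -> s2 x = z * x ->
  (forall i j, (i%:R == j%:R :> Q) = (i == j)) -> countably Q ->
  exists S : sfield p, countably S.
Proof.
move=> p0 s2p zp sz x0 sx natQ [f fI].
pose s3 := [the {rmorphism {poly Q} -> {poly Q}} of map_poly s2].
have s3p a : iter p s3 a = a.
  rewrite -[LHS]/(iter p (map_poly s2) a) iter_map_poly.
  by rewrite map_poly_id // => c _; rewrite itermE s2p.
have [s4 [s4E s4p]] := frac_aut p0 s3p.
pose t4 := [the {rmorphism {poly Q} -> {fraction {poly Q}}} of @FracField.tofrac {poly Q}].
have tI : injective t4 by move=> a b /eqP; rewrite /= tofrac_eq => /eqP.
have {}s4E a : s4 (t4 a) = t4 (s3 a) := s4E a.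
have fE (m : {fraction {poly Q}}) : exists a b, b != 0 /\ m = t4 a / t4 b := fracE m.
clearbody t4.
pose c := [the {rmorphism Q -> {fraction {poly Q}}} of t4 \o polyC].
have cs q : s4 (c q) = c (s2 q) by rewrite /= s4E /= map_polyC.
pose b (i : nat) : {poly Q} := 'X - (i%:R)%:P.
have t0 a : a != 0 -> t4 a != 0 by move=> a0; rewrite -(rmorph0 t4) (inj_eq tI).
have b0 i : t4 (b i) != 0 by rewrite t0 // polyXsubC_eq0.
have sb i : s4 (t4 (b i)) = t4 (b i).
  by rewrite s4E /= rmorphB /= map_polyX map_polyC /= rmorph_nat.
have cz : s4 (c z) = c z by rewrite cs sz.
have cx0 : c x != 0 by rewrite fmorph_eq0.
have csx : s4 (c x) = c z * c x by rewrite cs sx rmorphM.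
have zL : p.-primitive_root (c z) by rewrite fmorph_primitive_root.
have ind M (e : nat -> nat) m : \prod_(i < M) t4 (b i) ^+ e i = nrm s4 p m ->
    forall i, (i < M)%N -> (p %| e i)%N.
  have [a [d [d0 ->]]] := fE m => em i lti.
  pose u := \prod_(i < M) b i ^+ e i.
  have u0 : u != 0 by apply/prodf_neq0 => k _; rewrite expf_neq0 // polyXsubC_eq0.
  have eu : u * nrm s3 p d = nrm s3 p a.
    have tn q : t4 (nrm s3 p q) = nrm s4 p (t4 q).
      by apply: nrm_morph => q'; rewrite s4E.
    apply: tI; rewrite rmorphM !tn /u.
    have -> : t4 (\prod_(i < M) b i ^+ e i) = \prod_(i < M) t4 (b i) ^+ e i.
      by rewrite rmorph_prod; apply: eq_bigr => k _; rewrite rmorphXn.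
    by rewrite em -nrmM (divfK (t0 _ d0)).
  have s3I : injective s3.
    by move=> q y xy; rewrite -[q]s3p -[y]s3p -(prednK p0) !iterSr xy.
  have a0 : a != 0.
    apply: contraTneq (mulf_neq0 u0 (nrm_eq0 p s3I d0)) => a0; rewrite eu a0.
    by rewrite /nrm -(prednK p0) big_ord_recl /= mul0r eqxx.
  have s2i : s2 i%:R = i%:R by rewrite rmorph_nat.
  have := congr1 (mup (i%:R : Q)) eu; rewrite mupM ?(nrm_eq0 p s3I) // !mup_nrm //.
  rewrite /u (bigD1 (Ordinal lti)) //= mupMl; last first.
    rewrite /root horner_prod; apply/prodf_neq0 => k; rewrite -val_eqE /= => ki.
    by rewrite horner_exp hornerXsubC expf_neq0 // subr_eq0 natQ eq_sym.
  rewrite mup_XsubCX eqxx => h.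
  by rewrite -(dvdn_addl (e i) (dvdn_mulr (mup i%:R d) (dvdnn p))) h dvdn_mulr.
exists (@SField p _ s4 (c z) (c x) (fun i => t4 (b i)) s4p zL cz cx0 csx b0 sb ind).
apply: countably_frac.
exists (fun q : {poly Q} => pickle (map f (polyseq q))) => q q' /(pcan_inj pickleK) /(inj_map fI).
exact: val_inj.
Qed.

(** The field is the rational function field in one variable over [algC], with the automorphism
    multiplying the variable by [z]. The constants [algC] are countable, contain a primitive [p]-th
    root of unity, and have characteristic 0, which keeps the roots of the [X - i] distinct. *)
Lemma base_sfield p : (0 < p)%N -> exists S : sfield p, countably S.
Proof.
move=> p0; have [z zp] := C_prim_root_exists p0.
pose s1 := [the {rmorphism {poly algC} -> {poly algC}} of comp_poly (z *: 'X)].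
have s1X k : iter k s1 'X = z ^+ k *: 'X.
  elim: k => [|k IH]; first by rewrite scale1r.
  by rewrite iterS IH /= comp_polyZ comp_polyX scalerA exprSr.
have s1p a : iter p s1 a = a.
  rewrite -itermE; elim/poly_ind: a => [|a c IH]; first by rewrite rmorph0.
  rewrite rmorphD rmorphM IH [iterm s1 p 'X]itermE s1X (prim_expr_order zp) scale1r.
  congr (_ + _); rewrite itermE; apply: iter_fixed; exact: comp_polyC.
have [s2 [s2E s2p]] := frac_aut p0 s1p.
pose t2 := [the {rmorphism {poly algC} -> {fraction {poly algC}}} of @FracField.tofrac {poly algC}].
have tI : injective t2 by move=> a b /eqP; rewrite /= tofrac_eq => /eqP.
have {}s2E a : s2 (t2 a) = t2 (s1 a) := s2E a.
clearbody t2.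
pose c := [the {rmorphism algC -> {fraction {poly algC}}} of t2 \o polyC].
apply: (@poly_sfield p _ s2 (c z) (t2 'X)) => //.
- by rewrite fmorph_primitive_root.
- by rewrite /= s2E /= comp_polyC.
- by rewrite -(rmorph0 t2) (inj_eq tI) polyX_eq0.
- by rewrite s2E /= comp_polyX -mul_polyC rmorphM.
- move=> i j; rewrite -!(rmorph_nat c) (inj_eq (fmorph_inj c)); exact: eqr_nat.
- apply: countably_frac; exists (fun q : {poly algC} => pickle (polyseq q)).
  by move=> q q' /(pcan_inj pickleK)/val_inj.
Qed.

(** * Direct limits of fields *)

Definition ev (P : nat -> Prop) := exists N, forall n, (N <= n)%N -> P n.

Lemma evI P Q : ev P -> ev Q -> ev (fun n => P n /\ Q n).
Proof.
move=> [N HN] [M HM]; exists (maxn N M) => n; rewrite geq_max => /andP[h1 h2].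
by split; [apply: HN|apply: HM].
Qed.

Lemma evW (P Q : nat -> Prop) : (forall n, P n -> Q n) -> ev P -> ev Q.
Proof. by move=> PQ [N HN]; exists N => n /HN/PQ. Qed.

Section DirectLimit.
Local Open Scope quotient_scope.
Variables (L : nat -> fieldType) (phi : forall n, {rmorphism L n -> L n.+1}).

Definition coherent (x : forall n, L n) := ev (fun n => x n.+1 = phi n (x n)).

(* The limit is built from eventually coherent sequences up to eventual equality, rather than from
   pairs [(n, x)], so that its operations are pointwise. *)
Record cseq := CSeq { cs_val : forall n, L n; _ : `[< coherent cs_val >] }.
HB.instance Definition _ := [isSub for cs_val].
HB.instance Definition _ := [Choice of cseq by <:].

Definition eveq (x y : cseq) := `[< ev (fun n => cs_val x n = cs_val y n) >].

Lemma eveq_equiv : equiv_class_of eveq.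
Proof.
split=> [x|x y|y x z]; first by apply/asboolP; exists 0%N.
  by apply/asboolP/asboolP; apply: evW.
move=> /asboolP xy /asboolP yz; apply/asboolP.
by apply: evW (evI xy yz) => n [->].
Qed.
Canonical eveq_rel := EquivRelPack eveq_equiv.

Definition dlim := {eq_quot eveq_rel}.
HB.instance Definition _ : EqQuotient _ eveq_rel dlim := EqQuotient.on dlim.
HB.instance Definition _ := Choice.on dlim.

Definition rp (a : dlim) : forall n, L n := cs_val (repr a).

Lemma rp_coh a : coherent (rp a).
Proof. by rewrite /rp; case: (repr a) => x /= /asboolP. Qed.

Definition mk (x : forall n, L n) (cx : coherent x) : dlim :=
  \pi_dlim (@CSeq x (asboolT cx)).

Lemma rp_mk x (cx : coherent x) : ev (fun n => rp (mk cx) n = x n).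
Proof.
have /eqmodP/asboolP := reprK (mk cx); apply: evW => n.
by rewrite /rp => ->.
Qed.

Lemma dlim_ext a b : ev (fun n => rp a n = rp b n) -> a = b.
Proof. by move=> h; rewrite -[a]reprK -[b]reprK; apply/eqmodP/asboolP. Qed.

Lemma coh_const (c : forall n, L n) : (forall n, c n.+1 = phi n (c n)) -> coherent c.
Proof. by exists 0%N. Qed.

Lemma coh1 (f : forall n, L n -> L n) :
  (forall n x, f n.+1 (phi n x) = phi n (f n x)) ->
  forall a, coherent (fun n => f n (rp a n)).
Proof. by move=> fP a; apply: evW (rp_coh a) => n ->. Qed.

Lemma coh2 (f : forall n, L n -> L n -> L n) :
  (forall n x y, f n.+1 (phi n x) (phi n y) = phi n (f n x y)) ->
  forall a b, coherent (fun n => f n (rp a n) (rp b n)).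
Proof. by move=> fP a b; apply: evW (evI (rp_coh a) (rp_coh b)) => n [-> ->]. Qed.

Definition d0 := mk (@coh_const (fun n => 0) (fun n => esym (rmorph0 (phi n)))).
Definition d1 := mk (@coh_const (fun n => 1) (fun n => esym (rmorph1 (phi n)))).
Definition dopp a := mk (@coh1 (fun n x => - x) (fun n x => esym (rmorphN (phi n) x)) a).
Definition dinv a := mk (@coh1 (fun n x => x^-1) (fun n x => esym (fmorphV (phi n) x)) a).
Definition dadd a b :=
  mk (@coh2 (fun n x y => x + y) (fun n x y => esym (rmorphD (phi n) x y)) a b).
Definition dmul a b :=
  mk (@coh2 (fun n x y => x * y) (fun n x y => esym (rmorphM (phi n) x y)) a b).

Lemma rp_d0 : ev (fun n => rp d0 n = 0). Proof. exact: rp_mk. Qed.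
Lemma rp_d1 : ev (fun n => rp d1 n = 1). Proof. exact: rp_mk. Qed.
Lemma rp_dopp a : ev (fun n => rp (dopp a) n = - rp a n). Proof. exact: rp_mk. Qed.
Lemma rp_dinv a : ev (fun n => rp (dinv a) n = (rp a n)^-1). Proof. exact: rp_mk. Qed.
Lemma rp_dadd a b : ev (fun n => rp (dadd a b) n = rp a n + rp b n).
Proof. exact: (rp_mk (coh2 _ a b)). Qed.
Lemma rp_dmul a b : ev (fun n => rp (dmul a b) n = rp a n * rp b n).
Proof. exact: (rp_mk (coh2 _ a b)). Qed.

Lemma daddA : associative dadd.
Proof.
move=> a b c; apply: dlim_ext.
apply: evW (evI (evI (rp_dadd a (dadd b c)) (rp_dadd b c))
  (evI (rp_dadd (dadd a b) c) (rp_dadd a b))) => n [[-> ->] [-> ->]].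
exact: addrA.
Qed.
Lemma daddC : commutative dadd.
Proof.
move=> a b; apply: dlim_ext; apply: evW (evI (rp_dadd a b) (rp_dadd b a)) => n [-> ->].
exact: addrC.
Qed.
Lemma dadd0 : left_id d0 dadd.
Proof.
move=> a; apply: dlim_ext; apply: evW (evI (rp_dadd d0 a) rp_d0) => n [-> ->].
exact: add0r.
Qed.
Lemma daddN : left_inverse d0 dopp dadd.
Proof.
move=> a; apply: dlim_ext.
apply: evW (evI (evI (rp_dadd (dopp a) a) (rp_dopp a)) rp_d0) => n [[-> ->] ->].
exact: addNr.
Qed.
HB.instance Definition _ := GRing.isZmodule.Build dlim daddA daddC dadd0 daddN.

Lemma dmulA : associative dmul.
Proof.
move=> a b c; apply: dlim_ext.
apply: evW (evI (evI (rp_dmul a (dmul b c)) (rp_dmul b c))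
  (evI (rp_dmul (dmul a b) c) (rp_dmul a b))) => n [[-> ->] [-> ->]].
exact: mulrA.
Qed.
Lemma dmulC : commutative dmul.
Proof.
move=> a b; apply: dlim_ext; apply: evW (evI (rp_dmul a b) (rp_dmul b a)) => n [-> ->].
exact: mulrC.
Qed.
Lemma dmul1 : left_id d1 dmul.
Proof.
move=> a; apply: dlim_ext; apply: evW (evI (rp_dmul d1 a) rp_d1) => n [-> ->].
exact: mul1r.
Qed.
Lemma dmulDl : left_distributive dmul dadd.
Proof.
move=> a b c; apply: dlim_ext.
apply: evW (evI (evI (rp_dmul (dadd a b) c) (rp_dadd a b))
  (evI (rp_dadd (dmul a c) (dmul b c)) (evI (rp_dmul a c) (rp_dmul b c)))).
move=> n [[-> ->] [-> [-> ->]]]; exact: mulrDl.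
Qed.
Lemma d1_neq0 : d1 != d0.
Proof.
apply/eqP => e; have [N /(_ N (leqnn N))[e1 e0]] := evI rp_d1 rp_d0.
by move: e1; rewrite e e0 => /eqP; rewrite eq_sym oner_eq0.
Qed.
HB.instance Definition _ := GRing.Zmodule_isComNzRing.Build dlim dmulA dmulC dmul1 dmulDl d1_neq0.

Lemma rp_neq0 (a : dlim) : a != 0 -> ev (fun n => rp a n != 0).
Proof.
move=> a0; have [N cN] := rp_coh a.
have [z|nz] := pselect (exists2 n, (N <= n)%N & rp a n = 0).
  case/eqP: a0; apply: dlim_ext; have [n0 len z0] := z.
  apply: evW (evI (ex_intro _ n0 _) rp_d0) => [n [e ->]|]; first exact: e.
  elim=> [|n IH]; first by rewrite leqn0 => /eqP e; rewrite e in z0.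
  rewrite leq_eqVlt => /orP[/eqP e|]; first by rewrite e in z0.
  rewrite ltnS => le; rewrite cN ?IH ?rmorph0 //; exact: leq_trans le.
by exists N => n le; apply/eqP => z; apply: nz; exists n.
Qed.

Lemma dmulV (a : dlim) : a != 0 -> dmul (dinv a) a = 1.
Proof.
move=> /rp_neq0 a0; apply: dlim_ext.
apply: evW (evI a0 (evI (evI (rp_dmul (dinv a) a) (rp_dinv a)) rp_d1)) => n [an0 [[-> ->] ->]].
exact: mulVf.
Qed.
Lemma dinv0 : dinv 0 = 0.
Proof.
apply: dlim_ext; apply: evW (evI (rp_dinv d0) rp_d0) => n [-> ->]; exact: invr0.
Qed.
HB.instance Definition _ := GRing.ComNzRing_isField.Build dlim dmulV dinv0.

Definition cst_at n (x : L n) m : L m :=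
  if n =P m is ReflectT e then ecast k (L k) e x else 0.

(** The value is 0 below level [n], and from [n] on it is the image of [x] along the maps [phi]. *)
Fixpoint push n (x : L n) (m : nat) : L m :=
  if m is k.+1 then (if n == k.+1 then cst_at x k.+1 else phi k (push x k))
  else cst_at x 0.

Lemma push_id n (x : L n) : push x n = x.
Proof.
have c : cst_at x n = x by rewrite /cst_at; case: eqP => // e; rewrite eq_axiomK.
by case: n x c => [|n] x c //=; rewrite eqxx.
Qed.

Lemma push_succ n (x : L n) m : (n <= m)%N -> push x m.+1 = phi m (push x m).
Proof. by move=> le /=; rewrite ltn_eqF. Qed.

Lemma push_ind n (P : forall m, L m -> Prop) (x : L n) : P n x ->
  (forall m y, (n <= m)%N -> P m y -> P m.+1 (phi m y)) -> forall m, (n <= m)%N -> P m (push x m).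
Proof.
move=> P0 PS; elim=> [|m IH] le.
  by have e : n = 0%N by [apply/eqP; rewrite -leqn0]; subst n; rewrite push_id.
move: le; rewrite leq_eqVlt => /orP[/eqP e|]; first by subst n; rewrite push_id.
by rewrite ltnS => le; rewrite push_succ //; apply: PS => //; apply: IH.
Qed.

Lemma push_coh n (x : L n) : coherent (push x).
Proof. by exists n => m /push_succ. Qed.

Definition dinj n (x : L n) : dlim := mk (push_coh x).

Lemma dinj_ext n (x : L n) a : ev (fun m => push x m = rp a m) -> dinj x = a.
Proof.
by move=> h; apply: dlim_ext; apply: evW (evI (rp_mk (push_coh x)) h) => m [-> ->].
Qed.

Lemma dinj_eq n (x : L n) n' (x' : L n') : ev (fun m => push x m = push x' m) -> dinj x = dinj x'.
Proof.
move=> e; apply: dlim_ext; apply: evW (evI e (evI (rp_mk (push_coh x)) (rp_mk (push_coh x')))).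
by move=> m [e' [-> ->]].
Qed.

Lemma push_morph n m : (n <= m)%N ->
  [/\ forall x y : L n, push (x - y) m = push x m - push y m,
      forall x y : L n, push (x * y) m = push x m * push y m & push (1 : L n) m = 1].
Proof.
elim: m => [|m IH] le.
  have e : n = 0%N by [apply/eqP; rewrite -leqn0]; subst n.
  by split=> *; rewrite !push_id.
move: le; rewrite leq_eqVlt => /orP[/eqP e|]; first by subst n; split=> *; rewrite !push_id.
rewrite ltnS => le; have [hB hM h1] := IH le.
split=> *; rewrite !push_succ // ?hB ?hM ?h1; [exact: rmorphB|exact: rmorphM|exact: rmorph1].
Qed.

Lemma dinj_zmod n : zmod_morphism (@dinj n).
Proof.
move=> x y; apply: dlim_ext.
apply: evW (evI (rp_mk (push_coh (x - y))) (evI (rp_dadd (dinj x) (- dinj y))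
  (evI (rp_dopp (dinj y)) (evI (rp_mk (push_coh x)) (evI (rp_mk (push_coh y))
   (ex_intro _ n (fun m => @push_morph n m))))))) => m [-> [-> [-> [-> [-> [hB _ _]]]]]].
exact: hB.
Qed.

Lemma dinj_monoid n : monoid_morphism (@dinj n).
Proof.
split.
  apply: dlim_ext; apply: evW (evI (rp_mk (push_coh (1 : L n))) (evI rp_d1
    (ex_intro _ n (fun m => @push_morph n m)))) => m [-> [-> [_ _ h1]]]; exact: h1.
move=> x y; apply: dlim_ext.
apply: evW (evI (rp_mk (push_coh (x * y))) (evI (rp_dmul (dinj x) (dinj y))
  (evI (rp_mk (push_coh x)) (evI (rp_mk (push_coh y))
   (ex_intro _ n (fun m => @push_morph n m)))))) => m [-> [-> [-> [-> [_ hM _]]]]].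
exact: hM.
Qed.

Lemma dinj_succ n (x : L n) : dinj (phi n x) = dinj x.
Proof.
apply: dinj_eq; exists n.+1; apply: (@push_ind n.+1 (fun m y => y = push x m)).
  by rewrite push_succ // push_id.
by move=> m y le ->; rewrite push_succ // ltnW.
Qed.

Lemma dinj_surj a : exists n (x : L n), a = dinj x.
Proof.
have [N cN] := rp_coh a; exists N, (rp a N); apply/esym/dinj_ext; exists N.
apply: (@push_ind N (fun m y => y = rp a m)) => // m y le ->.
by rewrite cN.
Qed.

Theorem direct_limit : exists (F : fieldType) (i : forall n, {rmorphism L n -> F}),
  (forall n x, i n.+1 (phi n x) = i n x) /\ (forall a, exists n x, a = i n x).
Proof.
pose i n : {rmorphism L n -> dlim} := HB.pack (@dinj n)
  (GRing.isZmodMorphism.Build _ _ _ (@dinj_zmod n)) (GRing.isMonoidMorphism.Build _ _ _ (@dinj_monoid n)).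
by exists dlim, i; split; [exact: dinj_succ|exact: dinj_surj].
Qed.

End DirectLimit.

(** * The closed tower *)

Section LimitSField.
Variables (p : nat) (S : nat -> sfield p) (phi : forall n, {rmorphism S n -> S n.+1}).
Hypothesis phiP : forall n, smor (phi n).

Theorem sfield_limit : exists (F : sfield p) (i : forall n, {rmorphism S n -> F}),
  [/\ forall n, smor (i n), forall n x, i n.+1 (phi n x) = i n x &
      forall a, exists n x, a = i n x].
Proof.
have [F [i [iphi isur]]] := direct_limit phi.
have up n m (x : S n) : (n <= m)%N -> exists y : S m, i m y = i n x /\ i m (sg _ y) = i n (sg _ x).
  elim: m => [|m IH].
    by rewrite leqn0 => /eqP e; subst n; exists x.
  rewrite leq_eqVlt => /orP[/eqP e|]; first by subst n; exists x.
  rewrite ltnS => /IH[y [e1 e2]]; exists (phi m y).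
  by have [<- _ _ _] := phiP m; rewrite !iphi.
have isg n m (x : S n) (y : S m) : i n x = i m y -> i n (sg _ x) = i m (sg _ y).
  move=> e; have [x' [ex ex']] := up _ _ x (leq_maxl n m).
  have [y' [ey ey']] := up _ _ y (leq_maxr n m).
  have exy : x' = y' by apply: (fmorph_inj (i (maxn n m))); rewrite ex ey.
  by rewrite -ex' -ey' exy.
(* The automorphism is well defined since two preimages of [a] can be compared at a common later
   stage. *)
have /choice[st stP] : forall a : F, exists b, forall n x, a = i n x -> b = i n (sg _ x).
  by move=> a; have [n [x ->]] := isur a; exists (i n (sg _ x)) => m y; apply: isg.
have sti n x : st (i n x) = i n (sg _ x) by apply: stP.
have common a b : exists n (x y : S n), a = i n x /\ b = i n y.
  have [n [x ->]] := isur a; have [m [y ->]] := isur b.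
  have [x' [ex _]] := up _ _ x (leq_maxl n m); have [y' [ey _]] := up _ _ y (leq_maxr n m).
  by exists (maxn n m), x', y'.
have [s sE] : exists s : {rmorphism F -> F}, s =1 st.
  apply: mk_rmorphism.
    move=> a b; have [n [x [y [-> ->]]]] := common a b.
    by rewrite -rmorphB !sti !rmorphB.
  split; first by rewrite -(rmorph1 (i 0%N)) sti !rmorph1.
  move=> a b; have [n [x [y [-> ->]]]] := common a b.
  by rewrite -rmorphM !sti !rmorphM.
have si n x : s (i n x) = i n (sg _ x) by rewrite sE sti.
have sp a : iter p s a = a.
  have [n [x ->]] := isur a; rewrite (iter_morph (f := sg (S n)) (h := i n)) ?sg_p //.
have iz n : i n (zt (S n)) = i 0%N (zt (S 0%N)).
  by elim: n => // n <-; have [_ <- _ _] := phiP n; rewrite iphi.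
have ix n : i n (xx (S n)) = i 0%N (xx (S 0%N)).
  by elim: n => // n <-; have [_ _ <- _] := phiP n; rewrite iphi.
have ib n k : i n (bb (S n) k) = i 0%N (bb (S 0%N) k).
  by elim: n => // n <-; have [_ _ _ <-] := phiP n; rewrite iphi.
have zp : p.-primitive_root (i 0%N (zt (S 0%N))) by rewrite fmorph_primitive_root zt_prim.
have sz : s (i 0%N (zt (S 0%N))) = i 0%N (zt (S 0%N)) by rewrite si sg_zt.
have x0 : i 0%N (xx (S 0%N)) != 0 by rewrite fmorph_eq0 xx_neq0.
have sx : s (i 0%N (xx (S 0%N))) = i 0%N (zt (S 0%N)) * i 0%N (xx (S 0%N)).
  by rewrite si sg_xx rmorphM.
have b0 k : i 0%N (bb (S 0%N) k) != 0 by rewrite fmorph_eq0 bb_neq0.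
have sb k : s (i 0%N (bb (S 0%N) k)) = i 0%N (bb (S 0%N) k) by rewrite si sg_bb.
(* A relation involves a single element [m], which comes from some stage, so it already holds
   there. *)
have ind M (e : nat -> nat) m : \prod_(k < M) i 0%N (bb (S 0%N) k) ^+ e k = nrm s p m ->
    forall k, (k < M)%N -> (p %| e k)%N.
  have [n [x ->]] := isur m => em; apply: (@bb_indep p (S n) M e x).
  apply: (fmorph_inj (i n)); rewrite (nrm_morph (g := s)) => [|a]; last by rewrite si.
  rewrite -em rmorph_prod; apply: eq_bigr => k _; by rewrite rmorphXn ib.
pose F' : sfield p := @SField p F s (i 0%N (zt (S 0%N))) (i 0%N (xx (S 0%N)))
  (fun k => i 0%N (bb (S 0%N) k)) sp zp sz x0 sx b0 sb ind.
by exists F', i; split=> // n; split=> // a; rewrite si.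
Qed.

End LimitSField.

Section Tower.
Variables (p q : nat).
Hypothesis p_gt0 : (0 < p)%N.
Let n := q.+1.

Record task (L : Type) := Task { tC : 'M[L]_n; tH : 'M[L]_n; ti : nat; tj : nat }.

Definition map_task (L L' : Type) (f : L -> L') (t : task L) : task L' :=
  Task (map_mx f (tC t)) (map_mx f (tH t)) (ti t) (tj t).

Definition valid (S : sfield p) (t : task S) :=
  [/\ ti t <> tj t, map_mx (sg S) (tC t) = tC t, tC t *m tH t = tH t *m tC t,
      kry (tC t) (delta_mx 0 0) = 1%:M & mxnrm (sg S) p (tH t) = (bb S (ti t))%:M].

Definition solved (S : sfield p) (t : task S) :=
  exists Z, tC t *m Z = Z *m tC t /\ mxnrm (sg S) p Z = (bb S (tj t))%:M.

Lemma map_mxnrm (S S' : sfield p) (f : {rmorphism S -> S'}) (H : 'M[S]_n) : smor f ->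
  map_mx f (mxnrm (sg S) p H) = mxnrm (sg S') p (map_mx f H).
Proof.
move=> [fs _ _ _]; suff E k : map_mx f (\prod_(i < k) map_mx (iter i (sg S)) H) =
    \prod_(i < k) map_mx (iter i (sg S')) (map_mx f H) by exact: E.
elim: k => [|k IH]; first by rewrite !big_ord0 map_mx1.
rewrite !big_ord_recr /= -mulmxE map_mxM IH; congr (_ *m _).
by apply/matrixP => i j; rewrite !mxE (iter_morph (f := sg S) (h := f)).
Qed.

(** The converse direction, by injectivity of [f], lets a task that is valid over the limit be
    treated as valid at a finite stage. *)
Lemma map_valid (S S' : sfield p) (f : {rmorphism S -> S'}) (t : task S) : smor f ->
  valid t <-> valid (map_task f t).
Proof.
move=> fm; have [fs _ _ fb] := fm.
have I m1 m2 : injective (@map_mx _ _ f m1 m2) by apply: map_mx_inj; apply: fmorph_inj.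
have E1 : map_mx (sg S') (map_mx f (tC t)) = map_mx f (map_mx (sg S) (tC t)).
  by apply/matrixP => i j; rewrite !mxE fs.
have E4 : kry (map_mx f (tC t)) (delta_mx 0 0) = map_mx f (kry (tC t) (delta_mx 0 0)).
  by rewrite map_kry map_delta_mx.
rewrite /valid /= E1 E4 -map_mxnrm // -!map_mxM -fb -(map_mx1 f) -map_scalar_mx.
split=> [[h1 -> -> -> ->]|[h1 h2 h3 h4 h5]] //; split=> //; exact: I.
Qed.

Lemma map_solved (S S' : sfield p) (f : {rmorphism S -> S'}) (t : task S) : smor f ->
  solved t -> solved (map_task f t).
Proof.
move=> fm [Z [h1 h2]]; exists (map_mx f Z) => /=; rewrite -!map_mxM h1 -map_mxnrm // h2.
by have [_ _ _ <-] := fm; rewrite map_scalar_mx.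
Qed.

Lemma task_ext (S : sfield p) (t : task S) : countably S ->
  exists (S' : sfield p) (f : {rmorphism S -> S'}),
    [/\ countably S', smor f & valid t -> solved (map_task f t)].
Proof.
move=> cS; have [[h1 h2 h3 h4 h5]|nv] := pselect (valid t).
  have [S' [f [cS' fm HZ]]] := step_ext p_gt0 h1 h2 h3 h4 h5 cS.
  by exists S', f; split.
by exists S, [the {rmorphism S -> S} of idfun]; split.
Qed.

Lemma countably_task (L : choiceType) : countably L -> exists e : nat -> option (task L),
  forall t, exists c, e c = Some t.
Proof.
move=> [c cI].
pose code (t : task L) := pickle (([seq c (tC t i j) | i <- enum 'I_n, j <- enum 'I_n],
  [seq c (tH t i j) | i <- enum 'I_n, j <- enum 'I_n]), (ti t, tj t)).
have codeI : injective code.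
  have mxI (A B : 'M[L]_n) : [seq c (A i j) | i <- enum 'I_n, j <- enum 'I_n] =
     [seq c (B i j) | i <- enum 'I_n, j <- enum 'I_n] -> A = B.
    move=> e; apply/matrixP => i j; apply: cI.
    have e2 : [seq [seq c (A i j) | j <- enum 'I_n] | i <- enum 'I_n] =
              [seq [seq c (B i j) | j <- enum 'I_n] | i <- enum 'I_n].
      apply: eq_from_flatten_shape => //.
      by rewrite /shape -!map_comp; apply: eq_map => k /=; rewrite !size_map.
    have /eq_in_map/(_ i (mem_enum _ _)) := e2.
    by move=> /eq_in_map/(_ j (mem_enum _ _)).
  move=> [C H i j] [C' H' i' j'] /(pcan_inj pickleK)[/mxI -> /mxI -> -> ->].
  by [].
have /choice[e eP] : forall k, exists o : option (task L), forall t, code t = k -> o = Some t.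
  move=> k; have [[t <-]|nt] := pselect (exists t, code t = k).
    by exists (Some t) => t' /codeI ->.
  by exists None => t tk; case: nt; exists t.
by exists e => t; exists (code t); apply: eP.
Qed.

(* [st_q r] enumerates the tasks that are defined over the field of stage [r]. *)
Record state := State { st_S : sfield p; st_c : countably st_S;
  st_q : nat -> nat -> option (task st_S) }.

Definition unpair k := (logn 2 k, logn 3 k).

(** The bound [r <= k] guarantees that a task enumerated at stage [r] already exists when its turn
    comes at step [k]. *)
Lemma unpair_surj r c : exists k, (r <= k)%N /\ unpair k = (r, c).
Proof.
exists (2 ^ r * 3 ^ c)%N; split.
  by rewrite (leq_trans (ltnW (ltn_expl r (isT : 1 < 2)%N))) // leq_pmulr ?expn_gt0.
by rewrite /unpair !lognM ?expn_gt0 // !lognX !logn_prime //= !muln1 !muln0 addn0.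
Qed.

Definition next_spec (st : state) (k : nat) (st' : state) (f : {rmorphism st_S st -> st_S st'}) :=
  [/\ smor f,
      forall t, st_q st (unpair k).1 (unpair k).2 = Some t -> valid t -> solved (map_task f t),
      forall r c, (r <= k)%N -> st_q st' r c = omap (map_task f) (st_q st r c) &
      forall t, exists c, st_q st' k.+1 c = Some t].

Lemma next_ex st k : exists st' f, @next_spec st k st' f.
Proof.
case: st => S cS Q.
have [S' [f [cS' fm fs]]] : exists (S' : sfield p) (f : {rmorphism S -> S'}),
    [/\ countably S', smor f &
        forall t, Q (unpair k).1 (unpair k).2 = Some t -> valid t -> solved (map_task f t)].
  case E: (Q _ _) => [t|].
    have [S' [f [h1 h2 h3]]] := task_ext t cS.
    by exists S', f; split=> // _ [<-].
  by exists S, [the {rmorphism S -> S} of idfun]; split.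
have [e eP] := countably_task cS'.
exists (@State S' cS' (fun r c => if (r <= k)%N then omap (map_task f) (Q r c) else e c)), f.
split=> //= [r c ->//|t]; rewrite ltnn; exact: eP.
Qed.

Definition next st k : state := projT1 (cid (next_ex st k)).
Definition next_f st k : {rmorphism st_S st -> st_S (next st k)} :=
  projT1 (cid (projT2 (cid (next_ex st k)))).
Lemma nextP st k : next_spec k (next_f st k).
Proof. exact: projT2 (cid (projT2 (cid (next_ex st k)))). Qed.

Theorem closed_sfield : exists F : sfield p, forall t : task F, valid t -> solved t.
Proof.
have [S0 cS0] := base_sfield p_gt0.
pose T := fix T k := if k is k'.+1 then next (T k') k' else @State S0 cS0 (fun _ _ => None).
pose phi k : {rmorphism st_S (T k) -> st_S (T k.+1)} := next_f (T k) k.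
have phiP k : next_spec k (phi k) := nextP (T k) k.
have phim k : smor (phi k) by have [] := phiP k.
have [F [i [im iphi isur]]] := sfield_limit phim.
exists F => t vt.
have mxsur (A : 'M[F]_n) : exists N, forall m, (N <= m)%N -> exists A' : 'M[st_S (T m)]_n,
    map_mx (i m) A' = A.
  have up a : exists N, forall m, (N <= m)%N -> exists x, i m x = a.
    have [N [x ->]] := isur a; exists N; elim=> [|m IH].
      by rewrite leqn0 => /eqP e; subst N; exists x.
    rewrite leq_eqVlt => /orP[/eqP e|]; first by subst N; exists x.
    by rewrite ltnS => /IH[y <-]; exists (phi m y); apply: iphi.
  have /choice[N HN] : forall ab : 'I_n * 'I_n, exists N, forall m, (N <= m)%N ->
      exists x, i m x = A ab.1 ab.2 by move=> ab; apply: up.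
  exists (\max_ab N ab) => m le.
  have /choice[x Hx] : forall ab : 'I_n * 'I_n, exists x, i m x = A ab.1 ab.2.
    by move=> ab; apply: HN; apply: leq_trans le; apply: leq_bigmax.
  by exists (\matrix_(a, b) x (a, b)); apply/matrixP => a b; rewrite !mxE Hx.
have [N1 H1] := mxsur (tC t); have [N2 H2] := mxsur (tH t).
(* A successor, because row [r] of the enumeration is filled in on passing from stage [r.-1] to
   stage [r]; nothing is enumerated at stage 0. *)
pose r := (maxn N1 N2).+1.
have [C' hC] := H1 r (leqW (leq_maxl _ _)); have [H' hH] := H2 r (leqW (leq_maxr _ _)).
pose tr := Task C' H' (ti t) (tj t).
have etr : map_task (i r) tr = t by rewrite /map_task /= hC hH; case: (t).
have [c ec] : exists c, st_q (T r) r c = Some tr by have [_ _ _] := phiP (maxn N1 N2); apply.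
have [k [lek uk]] := unpair_surj r c.
have [tk [etk ek]] : exists tk, st_q (T k) r c = Some tk /\ map_task (i k) tk = t.
  elim: k lek {uk} => [|k IH]; first by rewrite leqn0 => /eqP.
  rewrite leq_eqVlt => /orP[/eqP e|].
    by rewrite -e; exists tr.
  rewrite ltnS => le; have [tk [e1 e2]] := IH le.
  have [_ _ h _] := phiP k; exists (map_task (phi k) tk); split.
    by have := h r c le; rewrite e1.
  rewrite -e2; case: tk {e1 e2} => A B a b; rewrite /map_task /=.
  by congr Task; apply/matrixP => x y; rewrite !mxE iphi.
have [_ h _ _] := phiP k; have := h tk; rewrite uk /= etk => /(_ erefl).
have vk : valid tk by apply/(map_valid tk (im k)); rewrite ek.
move=> /(_ vk)/(map_solved (im k.+1)).
congr solved; rewrite -ek; case: (tk) => A B a b; rewrite /map_task /=.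
by congr Task; apply/matrixP => x y; rewrite !mxE iphi.
Qed.

End Tower.

(** * Cyclic algebras *)

Section FixedField.
Variables (p : nat) (F : sfield p).

Definition fixpred : {pred F} := fun a => sg F a == a.

Lemma fixpred_closed : divring_closed fixpred.
Proof.
split=> [|a b|a b]; rewrite /in_mem /= /fixpred ?rmorph1 ?eqxx //.
  by move=> /eqP ea /eqP eb; rewrite rmorphB /= ea eb.
by move=> /eqP ea /eqP eb; rewrite fmorph_div /= ea eb.
Qed.
HB.instance Definition _ := GRing.isDivringClosed.Build F fixpred fixpred_closed.

Definition fixfld : fieldType := subfld (fixpred : divringClosed F).
Definition fval : {rmorphism fixfld -> F} := [the {rmorphism fixfld -> F} of val].

Lemma fvalK (k : fixfld) : sg F (fval k) = fval k.
Proof. exact: (eqP (valP k)). Qed.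

Lemma fval_inj : injective fval. Proof. exact: val_inj. Qed.

Lemma fval_ex a : sg F a = a -> exists k, fval k = a.
Proof.
move=> sa; have Pa : a \in (fixpred : divringClosed F) by apply/eqP.
by exists (SubFld Pa).
Qed.

Lemma fsg_inj : injective (sg F). Proof. exact: fmorph_inj. Qed.

Lemma sg_zX i : sg F (zt F ^+ i) = zt F ^+ i.
Proof. by rewrite rmorphXn /= sg_zt. Qed.

Lemma sg_iter_x k : iter k (sg F) (xx F) = zt F ^+ k * xx F.
Proof.
elim: k => [|k IH]; first by rewrite expr0 mul1r.
by rewrite iterS IH rmorphM /= sg_zX sg_xx mulrA -exprSr.
Qed.

Lemma xp_fix : sg F (xx F ^+ p) = xx F ^+ p.
Proof. by rewrite rmorphXn /= sg_xx exprMn prim_expr_order ?zt_prim // mul1r. Qed.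

Lemma iter_fval k (a : fixfld) : iter k (sg F) (fval a) = fval a.
Proof. exact/iter_fixed/fvalK. Qed.

End FixedField.

(** * Kummer theory: [F] as a vector space over the fixed field *)

Section Kummer.
Variables (q : nat) (F : sfield q.+1).
Let p := q.+1.
Let z := zt F.

Lemma p_neq0 : p%:R != 0 :> F.
Proof. exact: (prim_root_natf_neq0 (zt_prim F)). Qed.

Lemma z_neq0 : z != 0.
Proof.
by apply: contraTneq (oner_neq0 F) => z0; rewrite -(prim_expr_order (zt_prim F)) -/z z0 expr0n eqxx.
Qed.

(** Orthogonality of the characters of a cyclic group of order [p], by the geometric sum. *)
Lemma zX_sum (i j : 'I_p) : \sum_(m < p) (z ^+ i / z ^+ j) ^+ m = (i == j)%:R * p%:R.
Proof.
have zj0 : z ^+ j != 0 by rewrite expf_neq0 ?z_neq0.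
case: eqVneq => [->|ni].
  rewrite divff // mul1r -[in RHS](card_ord p) -sumr_const; apply: eq_bigr => m _.
  by rewrite expr1n.
rewrite mul0r; set u := _ / _.
have u1 : u - 1 != 0.
  rewrite subr_eq0; apply: contra ni => /eqP e; apply/eqP/val_inj.
  have : z ^+ i == z ^+ j by rewrite -[z ^+ i](divfK zj0) -/u e mul1r.
  by rewrite (eq_prim_root_expr (zt_prim F)) /= !modn_small // => /eqP.
apply: (mulfI u1); rewrite mulr0 -subrX1 /u expr_div_n -!exprM !(mulnC _ p) !exprM.
by rewrite (prim_expr_order (zt_prim F)) !expr1n divr1 subrr.
Qed.

(* Lagrange resolvents: the coordinates of [l] on the basis [xx ^ i] of [F] over the fixed field. *)
Definition coordF (i : nat) (l : F) : F :=
  p%:R^-1 * (\sum_(m < p) (z ^+ i)^-1 ^+ m * iter m (sg F) l) / xx F ^+ i.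

Lemma coordF_fix i l : sg F (coordF i l) = coordF i l.
Proof.
rewrite /coordF !(rmorphM, fmorphV) rmorph_nat rmorphXn /= sg_xx exprMn invfM.
rewrite -!mulrA; congr (_ * _); rewrite mulrA; congr (_ * _).
rewrite rmorph_sum mulr_suml big_ord_recr /= big_ord_recl /= addrC; congr (_ + _).
  rewrite expr0 mul1r rmorphM rmorphXn fmorphV /= sg_zX -iterS sg_p.
  rewrite mulrAC -exprSr -exprVn -exprM mulnC exprM exprVn (prim_expr_order (zt_prim F)).
  by rewrite invr1 expr1n mul1r.
apply: eq_bigr => m _; rewrite rmorphM rmorphXn fmorphV /= sg_zX /bump /= add1n.
by rewrite mulrAC -exprSr.
Qed.

Lemma coordF_sum l : \sum_(i < p) coordF i l * xx F ^+ i = l.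
Proof.
have x0 i : xx F ^+ i != 0 by rewrite expf_neq0 ?xx_neq0.
transitivity (p%:R^-1 * \sum_(m < p) (\sum_(i < p) (z ^+ (ord0 : 'I_p) / z ^+ m) ^+ i) * iter m (sg F) l).
  under eq_bigr => i _ do rewrite /coordF divfK //.
  rewrite -mulr_sumr exchange_big /=; congr (_ * _); apply: eq_bigr => m _.
  rewrite mulr_suml; apply: eq_bigr => i _; congr (_ * _).
  by rewrite expr0 mul1r -!exprVn -!exprM mulnC.
under eq_bigr => m _ do rewrite zX_sum.
rewrite (bigD1 ord0) //= ?eqxx !mul1r big1 ?addr0 ?mulKf ?p_neq0 // => m m0.
by rewrite eq_sym (negbTE m0) !mul0r.
Qed.

Lemma coordF_lin (k : fixfld F) (i : nat) (l l' : F) :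
  coordF i (fval F k * l + l') = fval F k * coordF i l + coordF i l'.
Proof.
pose S l := \sum_(m < p) (z ^+ i)^-1 ^+ m * iter m (sg F) l.
have E : S (fval F k * l + l') = fval F k * S l + S l'.
  rewrite /S mulr_sumr -big_split; apply: eq_bigr => m _ /=.
  by rewrite -!itermE rmorphD rmorphM !itermE iter_fval mulrDr mulrCA.
by rewrite /coordF -!/(S _) E mulrDr mulrDl mulrCA -!mulrA.
Qed.

Lemma coordF_x (i j : 'I_p) : coordF i (xx F ^+ j) = (i == j)%:R.
Proof.
rewrite /coordF.
have -> : \sum_(m < p) (z ^+ i)^-1 ^+ m * iter m (sg F) (xx F ^+ j) =
    (\sum_(m < p) (z ^+ j / z ^+ i) ^+ m) * xx F ^+ j.
  rewrite mulr_suml; apply: eq_bigr => m _.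
  rewrite -itermE rmorphXn itermE sg_iter_x !exprMn -!exprM mulrA; congr (_ * _).
  by rewrite mulnC mulrC.
rewrite zX_sum eq_sym; case: eqVneq => [->|_]; last by rewrite !mul0r mulr0 mul0r.
by rewrite mul1r mulKf ?p_neq0 // divff // expf_neq0 ?xx_neq0.
Qed.

End Kummer.

Section RowNorms.
Variables (n : nat) (R : comNzRingType) (s : {rmorphism R -> R}).

(** The twisted norm with its factors in the order opposite to [mxnrm], namely
    [s^(m-1)(A) ... s(A) A]: this is what iterating a semilinear map on row vectors produces. *)
Fixpoint rnrm r (A : 'M[R]_r) (m : nat) : 'M[R]_r :=
  if m is k.+1 then map_mx s (rnrm A k) *m A else 1%:M.

Lemma rnrm_iter r (B : 'M[R]_(r, n)) (S : 'M[R]_n) A m :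
  map_mx s B *m S = A *m B ->
  iter m (fun N => map_mx s N *m S) B = rnrm A m *m B.
Proof.
move=> e; elim: m => [|m IH]; first by rewrite mul1mx.
by rewrite iterS IH map_mxM -mulmxA e mulmxA.
Qed.
End RowNorms.

(** Keeping [b] in the type lets a different product be attached to the same row vectors for each
    [b]. *)
Definition calg (q : nat) (F : sfield q.+1) (b : fixfld F) : Type := 'rV[F]_q.+1.

Section CyclicAlgebra.
Variables (q : nat) (F : sfield q.+1) (b : fixfld F).
Let p := q.+1.
Local Notation A := (calg b).
Local Notation V := 'rV[F]_q.+1.

HB.instance Definition _ := GRing.Zmodule.on A.

Definition shiftmx : 'M[F]_q.+1 :=
  \matrix_(i < q.+1, k < q.+1)
    (if i == q :> nat then (k == 0 :> nat)%:R * fval F b else (k == i.+1 :> nat)%:R).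

Definition fy (v : V) : V := map_mx (sg F) v *m shiftmx.

Lemma fyD u v : fy (u + v) = fy u + fy v.
Proof. by rewrite /fy map_mxD mulmxDl. Qed.
Lemma fyZ l v : fy (l *: v) = sg F l *: fy v.
Proof. by rewrite /fy map_mxZ scalemxAl. Qed.
Lemma fy0 : fy 0 = 0. Proof. by rewrite /fy map_mx0 mul0mx. Qed.
Lemma fy_sum I (r : seq I) (f : I -> V) : fy (\sum_(i <- r) f i) = \sum_(i <- r) fy (f i).
Proof. exact: (big_morph fy fyD fy0). Qed.

Lemma fy_delta (i : 'I_q.+1) : (i < q)%N -> fy (delta_mx 0 i) = delta_mx 0 (inord i.+1).
Proof.
move=> lti; rewrite /fy map_delta_mx -rowE; apply/rowP => k; rewrite !mxE /= ltn_eqF //.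
by rewrite -val_eqE /= inordK.
Qed.

Lemma fy_last : fy (delta_mx 0 ord_max) = fval F b *: delta_mx 0 0.
Proof.
rewrite /fy map_delta_mx -rowE; apply/rowP => k; rewrite !mxE /= eqxx mulrC.
by rewrite -val_eqE.
Qed.

Lemma iter_fy_delta0 (j : 'I_q.+1) : iter j fy (delta_mx 0 0) = delta_mx 0 j.
Proof.
case: j => j ltj /=; elim: j ltj => [|j IH] ltj; first by congr delta_mx; apply: val_inj.
rewrite iterS IH ?(ltnW ltj) // => ltj'; rewrite fy_delta //.
by congr delta_mx; apply: val_inj; rewrite /= inordK.
Qed.

Lemma iter_fy_lin k l v : iter k fy (l *: v) = iter k (sg F) l *: iter k fy v.
Proof. by elim: k => //= k ->; rewrite fyZ. Qed.
Lemma iter_fyD k u v : iter k fy (u + v) = iter k fy u + iter k fy v.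
Proof. by elim: k => //= k ->; rewrite fyD. Qed.
Lemma iter_fy0 k : iter k fy 0 = 0.
Proof. by elim: k => //= k ->; rewrite fy0. Qed.
Lemma iter_fy_sum k I (r : seq I) (f : I -> V) :
  iter k fy (\sum_(i <- r) f i) = \sum_(i <- r) iter k fy (f i).
Proof. exact: (big_morph (iter k fy) (iter_fyD k) (iter_fy0 k)). Qed.

Lemma iter_fy_delta (j : 'I_q.+1) : iter p fy (delta_mx 0 j) = fval F b *: delta_mx 0 j.
Proof.
rewrite -iter_fy_delta0 -iterD addnC iterD.
have -> : iter p fy (delta_mx 0 0) = fval F b *: delta_mx 0 0.
  by rewrite /p iterS -[q]/(val (@ord_max q)) iter_fy_delta0 fy_last.
by rewrite iter_fy_lin iter_fval.
Qed.

Lemma iter_fy_p v : iter p fy v = fval F b *: v.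
Proof.
rewrite (row_sum_delta v) iter_fy_sum scaler_sumr; apply: eq_bigr => j _.
by rewrite iter_fy_lin sg_p iter_fy_delta !scalerA mulrC.
Qed.

(* [v] stands for [\sum_j v_j y^j] and [fy] for left multiplication by [y]. *)
Definition cmul (u v : A) : A := \sum_(j < q.+1) (u : V) 0 j *: iter j fy v.
Definition cone : A := delta_mx 0 0.

Lemma cmulDl (u v w : A) : cmul (u + v) w = cmul u w + cmul v w.
Proof. by rewrite /cmul -big_split; apply: eq_bigr => j _ /=; rewrite mxE scalerDl. Qed.
Lemma cmulDr (w u v : A) : cmul w (u + v) = cmul w u + cmul w v.
Proof. by rewrite /cmul -big_split; apply: eq_bigr => j _ /=; rewrite iter_fyD scalerDr. Qed.
Lemma cmulZl l (u v : V) : cmul (l *: u : V) v = l *: cmul u v :> V.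
Proof. by rewrite /cmul scaler_sumr; apply: eq_bigr => j _; rewrite mxE scalerA. Qed.
Lemma cmul0l v : cmul 0 v = 0.
Proof. by rewrite /cmul big1 // => j _; rewrite mxE scale0r. Qed.

Lemma cmul_suml I (r : seq I) (f : I -> V) (v : V) :
  cmul (\sum_(i <- r) f i : V) v = \sum_(i <- r) cmul (f i) v.
Proof.
by apply: (big_morph (fun u => cmul u v)) => [u w|]; [exact: cmulDl|exact: cmul0l].
Qed.
Lemma cmul_delta (j : 'I_q.+1) (v : V) : cmul (delta_mx 0 j : V) v = iter j fy v.
Proof.
rewrite /cmul (bigD1 j) //= mxE !eqxx scale1r big1 ?addr0 // => k kj.
by rewrite mxE (negbTE kj) scale0r.
Qed.

(** This is associativity with [y] as first factor; left [F]-linearity extends it to all products.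
    At the last power of [y] it rests on [y^p] acting as the scalar [b]. *)
Lemma cmul_fy (u v : V) : cmul (fy u : V) v = fy (cmul u v).
Proof.
rewrite {1}(row_sum_delta u) fy_sum cmul_suml [in RHS]/cmul fy_sum; apply: eq_bigr => j _.
rewrite !fyZ cmulZl; congr (_ *: _); have [e|ltj] := eqVneq (j : nat) q.
  have -> : j = ord_max by apply: val_inj.
  by rewrite fy_last cmulZl cmul_delta -iterS -/p iter_fy_p.
have ltj' : (j < q)%N by rewrite ltn_neqAle ltj -ltnS /=.
by rewrite fy_delta // cmul_delta inordK.
Qed.

Lemma cmul_iter_fy k (u v : V) : cmul (iter k fy u : V) v = iter k fy (cmul u v).
Proof. by elim: k => //= k <-; rewrite cmul_fy. Qed.

Lemma cmulA : associative cmul.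
Proof.
move=> u v w; rewrite {1 2}/cmul.
rewrite [in RHS]/cmul.
rewrite -[RHS]/(cmul (\sum_(j < q.+1) (u : V) 0 j *: iter j fy v : V) w) cmul_suml.
by apply: eq_bigr => j _; rewrite cmulZl cmul_iter_fy.
Qed.

Lemma cmul1l : left_id cone cmul.
Proof. by move=> v; exact: (cmul_delta ord0). Qed.

Lemma cmul1r : right_id cone cmul.
Proof.
move=> v; rewrite [RHS](row_sum_delta v); apply: eq_bigr => j _.
by rewrite iter_fy_delta0.
Qed.

Lemma cone_neq0 : cone != 0 :> A.
Proof.
apply/eqP => /rowP/(_ 0); rewrite !mxE !eqxx => /eqP; exact/negP/oner_neq0.
Qed.

HB.instance Definition _ := GRing.Zmodule_isNzRing.Build A cmulA cmul1l cmul1r cmulDl cmulDr cone_neq0.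

Definition cscale (k : fixfld F) (v : A) : A := fval F k *: (v : V).

Lemma cscaleA k k' v : cscale k (cscale k' v) = cscale (k * k') v.
Proof. by rewrite /cscale rmorphM; apply: scalerA. Qed.
Lemma cscale1 : left_id 1 cscale.
Proof. by move=> v; rewrite /cscale rmorph1 scale1r. Qed.
Lemma cscaleDr : right_distributive cscale +%R.
Proof. by move=> k u v; apply: scalerDr. Qed.
Lemma cscaleDl v : {morph cscale^~ v : k k' / k + k'}.
Proof. by move=> k k'; rewrite /cscale rmorphD; apply: scalerDl. Qed.
HB.instance Definition _ := GRing.Zmodule_isLmodule.Build (fixfld F) A cscaleA cscale1 cscaleDr cscaleDl.

Lemma cscaleAl (k : fixfld F) (u v : A) : k *: (u * v) = (k *: u) * v.
Proof. exact/esym/cmulZl. Qed.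
HB.instance Definition _ := GRing.Lmodule_isLalgebra.Build (fixfld F) A cscaleAl.

Lemma cscaleAr (k : fixfld F) (u v : A) : k *: (u * v) = u * (k *: v).
Proof.
rewrite -[LHS]/(fval F k *: (cmul u v : V)) -[RHS]/(cmul u (fval F k *: (v : V) : V)) /cmul scaler_sumr.
by apply: eq_bigr => j _; rewrite iter_fy_lin iter_fval !scalerA mulrC.
Qed.
HB.instance Definition _ := GRing.Lalgebra_isAlgebra.Build (fixfld F) A cscaleAr.

(** The coordinates are those of each entry on the powers of [xx], read off by the resolvents
    [coordF]. *)
Lemma calg_vect : Vector.axiom (p * p) A.
Proof.
have fixc i l : exists k, fval F k = coordF i l by apply/fval_ex/coordF_fix.
have /choice[c cP] : forall il : nat * F, exists k : fixfld F, fval F k = coordF il.1 il.2.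
  by move=> il; apply: fixc.
pose v2r (v : A) : 'rV[fixfld F]_(p * p) := mxvec (\matrix_(i < p, j < p) c (i : nat, (v : V) 0 j)).
pose r2v (r : 'rV[fixfld F]_(p * p)) : A :=
  (\row_j \sum_(i < p) fval F (vec_mx r i j) * xx F ^+ i : V).
exists v2r.
  move=> k u v; rewrite /v2r -linearP; congr mxvec; apply/matrixP => i j; rewrite !mxE.
  apply: (@fval_inj _ F); rewrite rmorphD rmorphM !cP /=.
  exact: coordF_lin.
exists r2v => [v|r].
  apply/rowP => j; rewrite mxE -[RHS]coordF_sum; apply: eq_bigr => i _.
  by rewrite mxvecK mxE cP.
rewrite /v2r -[RHS]vec_mxK; congr mxvec; apply/matrixP => i j; rewrite [LHS]mxE.
apply: (@fval_inj _ F); rewrite cP /= mxE.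
have E (G : 'I_p -> fixfld F) : coordF i (\sum_(m < p) fval F (G m) * xx F ^+ m) =
    \sum_(m < p) fval F (G m) * coordF i (xx F ^+ m).
  elim/big_rec2: _ => [|m y1 y2 _ IH].
    by rewrite /coordF big1 ?mulr0 ?mul0r // => m _; rewrite -itermE rmorph0 mulr0.
  by rewrite coordF_lin IH.
rewrite E (bigD1 i) //= coordF_x eqxx mulr1 big1 ?addr0 // => m mi.
by rewrite coordF_x eq_sym (negbTE mi) mulr0.
Qed.
HB.instance Definition _ := Lmodule_hasFinDim.Build (fixfld F) A calg_vect.
HB.instance Definition _ := Algebra_isFalgebra.Build (fixfld F) A.

End CyclicAlgebra.

Lemma dim_calg q (F : sfield q.+1) (b : fixfld F) : \dim {:calg b} = (q.+1 ^ 2)%N.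
Proof. by rewrite dimvf. Qed.

(** * Division, centre and homomorphisms of cyclic algebras *)

Section CalgTheory.
Variables (q : nat) (F : sfield q.+1) (b : fixfld F).
Local Notation A := (calg b).
Local Notation V := 'rV[F]_q.+1.
Local Notation fy := (fy b).
Let p := q.+1.

Definition ci (l : F) : A := (l *: delta_mx 0 0 : V).
Definition cy : A := (fy (delta_mx 0 0) : V).

Lemma ci_mul l (v : A) : ci l * v = (l *: (v : V) : V).
Proof. exact: (etrans (@cmulZl q F b l (delta_mx 0 0) v) (congr1 (fun w : V => l *: w) (cmul1l v))). Qed.

Lemma cy_mul (v : A) : cy * v = (fy v : V).
Proof. exact: (etrans (@cmul_fy q F b (delta_mx 0 0) v) (congr1 fy (cmul1l v))). Qed.

Lemma cyX_mul k (v : A) : cy ^+ k * v = (iter k fy v : V).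
Proof. by elim: k => [|k IH]; rewrite ?expr0 ?mul1r // exprS -mulrA IH cy_mul. Qed.

Lemma mul_ci (v : A) l : v * ci l = (\row_j ((v : V) 0 j * iter j (sg F) l) : V).
Proof.
rewrite -[LHS]/(cmul v (l *: delta_mx 0 0 : V)) /cmul [RHS]row_sum_delta.
by apply: eq_bigr => j _; rewrite iter_fy_lin iter_fy_delta0 mxE scalerA.
Qed.

Lemma calg_scale_ci (k : fixfld F) : k *: (1 : A) = ci (fval F k).
Proof. by []. Qed.

(** Right multiplication by [v] is linear over [F] acting on the left, so it has a matrix; its rows
    are the products [y^j v]. *)
Definition mulrmx (v : A) : 'M[F]_q.+1 := \matrix_(j < q.+1) (iter j fy v : V).

Lemma mulrmxE (u v : A) : u * v = ((u : V) *m mulrmx v : V).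
Proof.
rewrite -[LHS]/(cmul u v) mulmx_sum_row; apply: eq_bigr => j _; by rewrite rowK.
Qed.

Lemma fy_mulrmx (u : V) (v : A) : fy (u *m mulrmx v) = fy u *m mulrmx v.
Proof. by rewrite -(mulrmxE u v) -(mulrmxE (fy u) v) -cmul_fy. Qed.

(* A proper nonzero left ideal is an [F]-space of dimension [0 < r < p] on which [y] acts
   semilinearly; the determinant of its matrix has norm [b ^ r]. *)
Lemma calg_division : prime p -> (forall c, nrm (sg F) p c <> fval F b) -> is_division A.
Proof.
move=> pp nb.
have b0 : fval F b != 0.
  apply/eqP => b0; apply: (nb 0); rewrite b0 /nrm big_ord_recl /=.
  by rewrite mul0r.
have linv (d : A) : d != 0 -> exists e : A, e * d = 1.
  move=> d0; have [Mu|Mnu] := boolP (mulrmx d \in unitmx).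
    exists ((delta_mx 0 0 *m invmx (mulrmx d)) : V).
    by rewrite mulrmxE -mulmxA mulVmx // mulmx1.
  (* The row space of [M] is the left ideal generated by [d]; below, [A'] is the matrix of [y] on
     its basis [B]. *)
  pose M := mulrmx d; pose B := row_base M; pose r := \rank M.
  pose G (N : 'M[F]_(r, q.+1)) := map_mx (sg F) N *m shiftmx b.
  have rowG N i : row i (G N) = fy (row i N) by rewrite row_mul -map_row.
  have GB : (G B <= B)%MS.
    rewrite eq_row_base; apply/row_subP => i; rewrite rowG.
    have /submxP[D ->] : (row i B <= M)%MS by rewrite (submx_trans (row_sub i B)) ?eq_row_base.
    by rewrite fy_mulrmx submxMl.
  have /submxP[A' eA] := GB.
  have GNm m : iter m G B = rnrm (sg F) A' m *m B by apply: rnrm_iter.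
  have GpB : iter p G B = (fval F b)%:M *m B.
    have rowGm m i : row i (iter m G B) = iter m fy (row i B).
      by elim: m => //= m <-; rewrite rowG.
    by rewrite mul_scalar_mx; apply/row_matrixP => i; rewrite rowGm iter_fy_p [RHS]linearZ.
  have Np : rnrm (sg F) A' p = (fval F b)%:M.
    by apply: (row_free_inj (row_base_free M)); rewrite -GNm GpB.
  have detN m : \det (rnrm (sg F) A' m) = nrm (sg F) m (\det A').
    elim: m => [|m IH]; first by rewrite det1 /nrm big_ord0.
    rewrite /= det_mulmx det_map_mx IH /nrm big_ord_recl mulrC; congr (_ * _).
    by rewrite rmorph_prod; apply: eq_bigr => i _.
  have nr : nrm (sg F) p (\det A') = fval F b ^+ r by rewrite -detN Np det_scalar.
  have r_gt0 : (0 < r)%N.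
    rewrite lt0n mxrank_eq0; apply: contraNneq d0 => M0; apply/eqP.
    by have := rowK (fun j : 'I_q.+1 => iter j fy d) ord0; rewrite -/(mulrmx d) -/M M0 row0 /= => <-.
  have r_lt : (r < p)%N.
    by rewrite ltn_neqAle rank_leq_row andbT; apply: contra Mnu; rewrite -row_free_unit.
  (* As [p] is prime and [0 < r < p], Bezout gives [u r = v p + 1]. Since [b^(v p)] is the norm of
     [b^v], the norm [b^r] yields [b] itself as a norm. *)
  have [u v euv _] := egcdnP p r_gt0.
  have g1 : gcdn r p = 1%N by apply/eqP; rewrite -/(coprime r p) coprime_sym prime_coprime // gtnNdvd.
  case: (nb (\det A' ^+ u / fval F b ^+ v)).
  have vb0 : nrm (sg F) p (fval F b ^+ v) != 0 by rewrite nrm_eq0 ?expf_neq0 //; apply: fsg_inj.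
  apply: (mulIf vb0); rewrite -nrmM divfK ?expf_neq0 // !nrmX nr (nrm_fix _ (fvalK b)).
  by rewrite -!exprM -exprS mulnC euv g1 addn1 mulnC.
move=> d d0; have [e ed] := linv d d0.
have e0 : e != 0 by apply: contraNneq (oner_neq0 A) => e0; rewrite -ed e0 mul0r.
have [f fe] := linv e e0.
have fd : f = d by rewrite -[f]mulr1 -ed mulrA fe mul1r.
by apply/unitrP; exists e; rewrite -{2}fd.
Qed.

(** Right multiplication by [xx] multiplies the [k]-th coordinate by [zt^k xx], so an eigenvector
    for [zt^j] is supported at the index [j] modulo [p]. *)
Lemma ci_x_comm (v : A) j :
  (v * ci (xx F) : A) = (zt F ^+ j *: ((ci (xx F) * v : A) : V) : V) ->
  forall k : 'I_q.+1, (k : nat) <> (j %% p)%N -> (v : V) 0 k = 0.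
Proof.
rewrite mul_ci ci_mul => /rowP e k nk; have := e k; rewrite !mxE sg_iter_x.
rewrite mulrA [_ * (_ * (v : V) 0 k)]mulrA -[X in _ = X]mulrA [xx F * _]mulrC mulrA.
move=> /(mulIf (xx_neq0 F))/eqP; rewrite mulrC -subr_eq0 -mulrBl mulf_eq0 => /orP[|/eqP //].
rewrite subr_eq0 (eq_prim_root_expr (zt_prim F)) => /eqP ek.
by case: nk; rewrite -ek modn_small.
Qed.

Lemma row0_only (v : V) : (forall k : 'I_q.+1, (k : nat) <> 0%N -> v 0 k = 0) ->
  v = v 0 0 *: delta_mx 0 0.
Proof.
move=> v0; rewrite {1}(row_sum_delta v) (bigD1 0) //= big1 ?addr0 // => k k0.
rewrite v0 ?scale0r // => e; move: k0; rewrite -val_eqE /= e; by [].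
Qed.

Lemma fy_delta0_neq0 : fval F b != 0 -> fy (delta_mx 0 0) != 0.
Proof.
apply: contraNneq => e; have /rowP/(_ 0) := iter_fy_p b (delta_mx 0 0).
by rewrite iterSr e iter_fy0 !mxE !eqxx mulr1 => <-.
Qed.

(** Commuting with [xx] leaves only the coordinate at [y^0]; commuting with [y] then puts that
    coordinate in the fixed field. *)
Lemma calg_central : fval F b != 0 -> is_central A.
Proof.
move=> b0; apply/eqP; rewrite eqEsubv; apply/andP; split; last first.
  by rewrite -memvE memv_cap memvf centv1.
apply/subvP => d; rewrite memv_cap memvf /= => /centvP dc.
have dE : d = ci ((d : V) 0 0).
  apply: row0_only; apply: (ci_x_comm (j := 0)).
  by rewrite expr0 scale1r dc ?memvf.
set l := (d : V) 0 0 in dE.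
have /fval_ex[k ek] : sg F l = l.
  have e : l *: fy (delta_mx 0 0) = sg F l *: fy (delta_mx 0 0).
    by have := dc cy (memvf _); rewrite dE ci_mul cy_mul /ci fyZ.
  have : (l - sg F l) *: fy (delta_mx 0 0) == 0 by rewrite scalerBl e subrr.
  by rewrite scalemx_eq0 (negbTE (fy_delta0_neq0 b0)) orbF subr_eq0 => /eqP.
by rewrite dE -ek -calg_scale_ci memvZ // memv_line.
Qed.

Lemma ciM l l' : ci l * ci l' = ci (l * l').
Proof. by rewrite ci_mul /ci scalerA. Qed.

Lemma ciX l n : ci l ^+ n = ci (l ^+ n).
Proof. by elim: n => [|n IH]; rewrite ?expr0 ?/ci ?scale1r // !exprS IH ciM. Qed.

Lemma cy_ci l : cy * ci l = ci (sg F l) * cy.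
Proof. by rewrite cy_mul /ci fyZ ci_mul. Qed.

Lemma ci_cyX l k : (ci l * cy) ^+ k = ci (nrm (sg F) k l) * cy ^+ k.
Proof.
elim: k => [|k IH]; first by rewrite !expr0 mulr1 /nrm big_ord0 /ci scale1r.
rewrite exprS IH !mulrA -[ci l * cy * ci _]mulrA cy_ci mulrA ciM -mulrA -exprS.
congr (ci _ * _); rewrite /nrm big_ord_recl; congr (_ * _).
by rewrite rmorph_prod; apply: eq_bigr.
Qed.

Lemma cy_p : cy ^+ p = ci (fval F b).
Proof. by rewrite -[LHS]mulr1 cyX_mul iter_fy_p. Qed.

End CalgTheory.

(* The components of [1] for the operator [c |-> x' c x^-1], whose [p]-th power is the identity. *)
Lemma calg_eigen q (F : sfield q.+1) (b : fixfld F) (x' : calg b) :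
  x' ^+ q.+1 = ci b (xx F ^+ q.+1) ->
  exists (i : nat) (c : calg b), c != 0 /\ x' * c = ci b (zt F ^+ i) * c * ci b (xx F).
Proof.
set p := q.+1; set x := ci b (xx F) => x'p.
have x0 := xx_neq0 F.
pose y := ci b (xx F)^-1.
have xy : x * y = 1 by rewrite ciM divff // /ci scale1r.
have yx : y * x = 1 by rewrite ciM mulVf // /ci scale1r.
have [k ek] := fval_ex (sg_zt F).
have zi i (u : calg b) : ci b (zt F ^+ i) * u = k ^+ i *: u.
  by rewrite -ek -rmorphXn /= -calg_scale_ci -scalerAl mul1r.
have kp : p.-primitive_root k by rewrite -(fmorph_primitive_root (fval F)) ek zt_prim.
have k0 : k != 0.
  by apply: contraTneq (oner_neq0 (fixfld F)) => k0; rewrite -(prim_expr_order kp) k0 expr0n eqxx.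
pose c (i : nat) : calg b := \sum_(m < p) (k^-1 ^+ (i * m)) *: (x' ^+ m * y ^+ m).
have xp : x' ^+ p * y ^+ p = 1.
  have xpp : x ^+ p = x' ^+ p by rewrite x'p ciX.
  rewrite -xpp; elim: (p) => [|m IH]; first by rewrite mulr1.
  by rewrite exprSr exprS mulrA -(mulrA _ x) xy mulr1 IH.
have cE i : x' * c i * y = k ^+ i *: c i.
  rewrite mulr_sumr mulr_suml scaler_sumr [RHS]big_ord_recl [LHS]big_ord_recr addrC /=.
  congr (_ + _); last first.
    rewrite muln0 expr0 !scale1r -scalerAr -scalerAl mulrA -exprS -mulrA -exprSr xp mulr1 exprVn.
    have -> : k ^+ (i * q) = (k ^+ i)^-1 * k ^+ (i * p).
      by rewrite mulnS exprD mulrA mulVf ?mul1r // expf_neq0.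
    by rewrite mulnC exprM (prim_expr_order kp) expr1n mulr1 invrK.
  apply: eq_bigr => m _; rewrite -scalerAr -scalerAl mulrA -exprS -mulrA -exprSr scalerA.
  congr (_ *: _); rewrite /bump /= add1n mulnS exprD mulrA -exprMn mulfV //.
  by rewrite expr1n mul1r.
(* Summing over [i] leaves only the term [m = 0]. A primitive [p]-th root of unity forces [p] to be
   nonzero in the field, so some [c i] is nonzero. *)
have csum : \sum_(i < p) c i = p%:R *: 1.
  rewrite exchange_big (bigD1 ord0) //= [X in _ + X]big1 ?addr0.
    under eq_bigr => i _ do rewrite muln0 expr0 scale1r expr0 mul1r.
    by rewrite sumr_const card_ord scaler_nat.
  move=> m m0; rewrite -scaler_suml.
  suff -> : \sum_(i < p) k^-1 ^+ (i * m) = 0 by rewrite scale0r.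
  have u1 : k^-1 ^+ m - 1 != 0.
    rewrite subr_eq0 exprVn invr_eq1 -(expr0 k) (eq_prim_root_expr kp) mod0n modn_small //.
  apply: (mulfI u1); rewrite mulr0.
  under eq_bigr => i _ do rewrite mulnC exprM.
  by rewrite -subrX1 -exprM mulnC exprM exprVn (prim_expr_order kp) invr1 expr1n subrr.
have [i ci0] : exists i : 'I_p, c i != 0.
  apply: contrapT => nex; have : \sum_(i < p) c i = 0.
    by apply: big1 => i _; apply: contrapT => /eqP ci0; apply: nex; exists i.
  rewrite csum => /eqP; rewrite scaler_eq0 oner_eq0 orbF.
  by rewrite (negbTE (prim_root_natf_neq0 kp)).
exists i, (c i); split=> //.
by rewrite zi -cE -mulrA yx mulr1.
Qed.

Lemma ci_inj q (F : sfield q.+1) (b : fixfld F) : injective (ci b).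
Proof. by move=> l l' /rowP/(_ 0); rewrite !mxE !eqxx !mulr1. Qed.

Lemma cyX_ci q (F : sfield q.+1) (b : fixfld F) k l :
  cy b ^+ k * ci b l = ci b (iter k (sg F) l) * cy b ^+ k.
Proof.
elim: k => [|k IH]; first by rewrite expr0 mulr1 mul1r.
by rewrite exprS -mulrA IH mulrA cy_ci -mulrA.
Qed.

(* Skolem-Noether by hand: conjugating by [u] brings the image of [xx] back to [xx], and then the image
   of [y] has the form [l y']. *)
Lemma calg_hom_norm q (F : sfield q.+1) (b b' : fixfld F) (f : 'AHom(calg b, calg b')) :
  (0 < q)%N -> is_division (calg b') -> exists l, fval F b = nrm (sg F) q.+1 l * fval F b'.
Proof.
move=> q0 div; set p := q.+1.
have [z ez] := fval_ex (sg_zt F).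
have ciz (b0 : fixfld F) i (u : calg b0) : ci b0 (zt F ^+ i) * u = z ^+ i *: u.
  by rewrite -ez -rmorphXn /= -calg_scale_ci -scalerAl mul1r.
have fsc l : sg F l = l -> f (ci b l) = ci b' l.
  by move=> /fval_ex[k <-]; rewrite -!calg_scale_ci linearZ rmorph1.
pose x := ci b' (xx F); pose x' := f (ci b (xx F)); pose y' := f (cy b).
have x'p : x' ^+ p = ci b' (xx F ^+ p) by rewrite -rmorphXn /= ciX fsc // xp_fix.
have [i [c [c0 ec]]] := calg_eigen x'p; rewrite ciz -scalerAl in ec.
have y'x' : y' * x' = z *: (x' * y').
  rewrite /y' /x' -!rmorphM -linearZ; congr (f _).
  by rewrite cy_ci sg_xx -[zt F]expr1 -ciM ciz expr1 scalerAl.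
have cy0 : cy b' \is a GRing.unit.
  apply: div; apply/eqP => e; have /rowP/(_ (inord 1)) := e.
  by rewrite /cy fy_delta // !mxE !eqxx => /eqP; rewrite oner_eq0.
(* Moving [y^i] past [xx] produces [zt^i], which cancels the eigenvalue of [c]. *)
pose u := c * cy b' ^+ i.
have uu : u \is a GRing.unit by rewrite (unitrMl _ (unitrX i cy0)); exact: (div _ c0).
have x'u : x' * u = u * x.
  rewrite /u mulrA ec -[RHS]mulrA cyX_ci sg_iter_x -ciM ciz -!scalerAl -!scalerAr.
  by rewrite !mulrA.
clearbody u; pose w := u^-1 * y' * u.
have wx : w * x = z *: (x * w).
  have ux : u^-1 * x' = x * u^-1.
    by rewrite -[x'](mulrK uu) x'u mulrA mulKr.
  by rewrite /w -(mulrA _ u) -x'u !mulrA -(mulrA _ y') y'x' -scalerAr -!scalerAl mulrA ux ?mulrA.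
(* The relation [wx] makes [w] an eigenvector for [zt], hence a multiple of [y]. Its [p]-th power is
   [b] by conjugation, and the norm of the multiplier times [b'] by [ci_cyX]. *)
have wE : w = ci b' ((w : 'rV[F]_q.+1) 0 (inord 1)) * cy b'.
  have w0 : forall k : 'I_q.+1, (k : nat) <> 1%N -> (w : 'rV[F]_q.+1) 0 k = 0.
    have := @ci_x_comm q F b' w 1%N; rewrite modn_small //; apply.
    by rewrite expr1 -ez.
  rewrite ci_mul /cy fy_delta // [LHS](row_sum_delta w) (bigD1 (inord 1)) //= big1 ?addr0 //.
  move=> k k1; rewrite w0 ?scale0r // => e; case/eqP: k1; apply: val_inj; rewrite /= inordK //.
exists ((w : 'rV[F]_q.+1) 0 (inord 1)); apply: (@ci_inj q F b').
rewrite -ciM -cy_p -ci_cyX -wE.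
have wX k : w ^+ k = u^-1 * y' ^+ k * u.
  elim: k => [|k IH]; first by rewrite mulr1 mulVr.
  by rewrite exprS IH /w !mulrA mulrK // exprS !mulrA.
by rewrite wX /y' -rmorphXn /= cy_p fsc ?fvalK // -calg_scale_ci -scalerAr -scalerAl mulr1 mulVr.
Qed.

(** * Transfer of maximal subfields *)

Section EmbedGen.
Variables (K : fieldType) (E : fieldExtType K) (p : nat).
Hypothesis pp : prime p.
Hypothesis dimE : \dim {:E} = p.

(** In prime degree every element outside [K] is primitive, so an embedding of [E] only needs a root
    of the minimal polynomial of such an element. *)
Lemma embed_gen : exists (th : E) (f : {poly K}),
  [/\ f \is monic, size f = p.+1, irreducible_poly f, horner_alg th f = 0 &
    forall (A : falgType K) (d : A), horner_alg d f = 0 -> embeds_into E A].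
Proof.
have [th nth1] : exists th : E, th \notin (1%VS : {vspace E}).
  have /subvPn[th _ h] : ~~ ({:E} <= 1)%VS.
    by apply/negP => /dimvS; rewrite dimE dimv1 leqNgt prime_gt1.
  by exists th.
have dimth : \dim <<1; th>>%VS = p.
  have : (\dim <<1; th>>%VS %| p)%N by rewrite -dimE; apply: field_dimS; apply: subvf.
  move/(primeP pp).2 => /pred2P[e|//].
  case/negP: nth1; have : (<<1; th>>%VS <= 1)%VS.
    by rewrite -(geq_leqif (dimv_leqif_sup (subv_adjoin 1 th))) e dimv1.
  by move/subvP; apply; apply: memv_adjoin.
have full : (<<1; th>>%VS = {:E})%VS.
  by apply/eqP; rewrite eqEdim subvf dimth dimE leqnn.
have /polyOver1P[f ef] := minPolyOver 1 th.
have adp : adjoin_degree 1 th = p.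
  by have := dim_Fadjoin 1 th; rewrite dimth dimv1 muln1.
have dvd (g : {poly K}) : horner_alg th g = 0 -> f %| g.
  move=> g0; rewrite -(dvdp_map (in_alg E)) -ef; apply: minPoly_dvdp.
    by apply/polyOver1P; exists g.
  by apply/eqP.
exists th, f; split.
- by rewrite -(map_monic (in_alg E)) -ef monic_minPoly.
- by rewrite -(size_map_poly (in_alg E)) -ef size_minPoly adp.
- split; first by rewrite -(size_map_poly (in_alg E)) -ef size_minPoly adp ltnS prime_gt0.
  move=> g sg gf; have := @minPoly_irr _ _ 1%AS th (map_poly (in_alg E) g).
  rewrite ef dvdp_map gf => h.
  have gover : map_poly (in_alg E) g \is a polyOver 1%VS by apply/polyOver1P; exists g.
  have /orP[] := h gover isT; first by rewrite eqp_map.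
  by rewrite -(rmorph1 (map_poly (in_alg E))) eqp_map -size_poly_eq1 (negbTE sg).
- by apply/eqP; rewrite -[_ == 0]/(root (map_poly (in_alg E) f) th) -ef root_minPoly.
move=> A d fd.
have /choice[g gP] : forall e : E, exists g : {poly K}, e = horner_alg th g.
  move=> e; have /Fadjoin_polyP[r r1 er] : e \in <<1; th>>%VS by rewrite full memvf.
  by have /polyOver1P[g eg] := r1; exists g; rewrite er eg.
pose phi (e : E) := horner_alg d (g e).
have phiE r : phi (horner_alg th r) = horner_alg d r.
  apply/eqP; rewrite -subr_eq0 -rmorphB; have /dvdpP[s ->] : f %| g (horner_alg th r) - r.
    by apply: dvd; rewrite rmorphB /= -gP subrr.
  by rewrite rmorphM /= fd mulr0.
have phiz : zmod_morphism phi.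
  by move=> a c; rewrite [in LHS](gP a) [in LHS](gP c) -rmorphB /= phiE rmorphB.
have phim : monoid_morphism phi.
  split; first by rewrite -(rmorph1 (horner_alg th)) /= phiE rmorph1.
  by move=> a c; rewrite [in LHS](gP a) [in LHS](gP c) -rmorphM /= phiE rmorphM.
have phis : scalable phi.
  move=> k a; have e : k *: a = horner_alg th (k *: g a).
    by rewrite [RHS]linearZ /= -gP mulr_algl.
  by rewrite e phiE [LHS]linearZ /= mulr_algl.
pose h : {lrmorphism E -> A} := HB.pack phi (GRing.isZmodMorphism.Build _ _ phi phiz)
  (GRing.isMonoidMorphism.Build _ _ phi phim) (GRing.isScalable.Build _ _ _ _ phi phis).
by exists (AHom (linfun_is_ahom h)).
Qed.

End EmbedGen.

Section Irreducible.
Variables (p : nat) (F : sfield p) (f : {poly fixfld F}).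
Hypotheses (pp : prime p) (sf : size f = p.+1) (irf : irreducible_poly f).
Let fF := map_poly (fval F) f.

Lemma poly_fixed (g : {poly F}) : map_poly (sg F) g = g -> exists h, map_poly (fval F) h = g.
Proof.
move=> gs; have /choice[c cP] : forall i, exists k, fval F k = g`_i.
  by move=> i; apply: fval_ex; rewrite -[in RHS]gs coef_map.
exists (\poly_(i < size g) c i); apply/polyP => i; rewrite coef_map coef_poly.
by case: ltnP => h; [exact: cP|rewrite [LHS](rmorph0 (fval F)) nth_default].
Qed.

(* Over [F] the irreducible factors of [f] are conjugate under [sg], hence of the same degree, which
   divides [p]. *)
Lemma irr_root_or_coprime : (exists r, root fF r) \/
  (forall h : {poly F}, h != 0 -> (size h <= p)%N -> coprimep fF h).
Proof.
have p0 := prime_gt0 pp.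
have sfF : size fF = p.+1 by rewrite size_map_poly.
have fF0 : fF != 0 by rewrite -size_poly_gt0 sfF.
have [h0|nh] := pselect (exists h : {poly F}, [/\ h != 0, (size h <= p)%N & ~~ coprimep fF h]); last first.
  by right=> h h0 hp; apply: contrapT => /negP nc; apply: nh; exists h.
(* Size [k.+2] means degree [k.+1], positive and less than [p]. A factor of minimal degree is
   irreducible, and so are its conjugates. *)
have exg : exists k, `[< exists g : {poly F}, [/\ size g = k.+2, g %| fF & (k.+2 <= p)%N] >].
  have [h [hn hp nc]] := h0; exists (size (gcdp fF h)).-2.
  apply/asboolP; exists (gcdp fF h); rewrite dvdp_gcdl.
  have s1 : (1 < size (gcdp fF h))%N.
    move: nc; rewrite /coprimep; case: (size _) (size_poly_gt0 (gcdp fF h)) => [|[|]] //.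
    by rewrite gcdp_eq0 negb_and fF0.
  have -> : (size (gcdp fF h)).-2.+2 = size (gcdp fF h) by case: (size _) s1 => [|[]].
  by split=> //; apply: leq_trans hp; apply: dvdp_leq => //; apply: dvdp_gcdr.
case: (ex_minnP exg) => k /asboolP[g [sg1 gf kp]] kmin.
have min d : d %| fF -> size d != 1 -> (size d <= p)%N -> (k.+2 <= size d)%N.
  move=> df d1 dp; have d0 : d != 0 by apply: contraNneq fF0 => d0; rewrite -dvd0p -d0.
  have e : size d = (size d).-2.+2 by move: (d0) d1; rewrite -size_poly_gt0; case: (size d) => [|[]].
  rewrite e !ltnS; apply: kmin; apply/asboolP.
  by exists d; rewrite -e.
have g0 : g != 0 by rewrite -size_poly_gt0 sg1.
pose gi i := map_poly (iterm (sg F) i) g.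
have sgi i : size (gi i) = k.+2 by rewrite size_map_poly.
have fFs i : map_poly (iterm (sg F) i) fF = fF.
  by apply/polyP => j; rewrite !coef_map /= itermE iter_fval.
have gif i : gi i %| fF by rewrite -(fFs i) dvdp_map.
have girr i d : d %| gi i -> size d != 1 -> d %= gi i.
  move=> dg d1; rewrite -dvdp_size_eqp // sgi eqn_leq -{1}(sgi i) dvdp_leq ?min //.
  - exact: dvdp_trans dg (gif i).
  - by rewrite (leq_trans _ kp) // -(sgi i) dvdp_leq // -size_poly_gt0 sgi.
  - by rewrite -size_poly_gt0 sgi.
pose P := \prod_(i < p) gi i.
have PE : P = nrm (map_poly (sg F)) p g.
  by apply: eq_bigr => i _; rewrite iter_map_poly.
have Ps : map_poly (sg F) P = P.
  apply: (mulIf g0); rewrite PE nrm_iter; congr (_ * _).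
  rewrite iter_map_poly; apply/polyP => j; by rewrite coef_map /= itermE sg_p.
have [PK ePK] := poly_fixed Ps.
have gP : g %| P.
  rewrite /P (bigD1 (Ordinal p0)) //=; apply: dvdp_mulr.
  by rewrite /gi map_poly_id.
(* The norm [P] of [g] has coefficients in the fixed field and shares the factor [g] with [f], which
   is irreducible there. *)
have fP : fF %| P.
  rewrite -ePK dvdp_map; apply: contrapT => nfP.
  have : coprimep f PK.
    rewrite /coprimep; apply: contrapT => /negP gs.
    have /irf.2/(_ (dvdp_gcdl _ _)) /eqp_dvdl e := gs.
    by apply: nfP; rewrite -e dvdp_gcdr.
  rewrite -(coprimep_map (fval F)) -/fF ePK => /coprimepP/(_ g gf gP).
  by rewrite -size_poly_eq1 sg1.
(* A divisor of a product of irreducibles of degree [k.+1] has degree a multiple of [k.+1]. Applied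
   to [fF], of prime degree, this forces a linear factor. *)
have cnt m (d : {poly F}) : d %| \prod_(i < m) gi i -> (k.+1 %| (size d).-1)%N.
  elim: m d => [|m IH] d.
    by rewrite big_ord0 dvdp1 => /eqP ->.
  rewrite big_ord_recr /= => dP.
  have [cop|ncop] := boolP (coprimep d (gi m)).
    by apply: IH; rewrite -(Gauss_dvdpl _ cop).
  have gm0 : gi m != 0 by rewrite -size_poly_gt0 sgi.
  have gmd : gi m %| d.
    by have := girr m _ (dvdp_gcdr d (gi m)) ncop => /eqp_dvdl <-; apply: dvdp_gcdl.
  have /dvdpP[d' ed] := gmd; move: dP; rewrite ed dvdp_mul2r // => /IH.
  have [->|d'0] := eqVneq d' 0; first by rewrite mul0r.
  rewrite size_mul // sgi; move: (size_poly_gt0 d'); rewrite d'0; case: (size d') => // j _ /= h.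
  by rewrite addnS /= dvdn_addl.
have kdp : (k.+1 %| p)%N by have := cnt p fF fP; rewrite sfF.
have k1 : k = 0%N.
  have /primeP[_ /(_ _ kdp)/pred2P[[]//|e]] := pp.
  by rewrite e ltnn in kp.
left; have [r rg] : {r | root g r} by apply: poly2_root; rewrite sg1 k1.
exists r; have /dvdpP[d ->] := gf; by rewrite rootM rg orbT.
Qed.

End Irreducible.

Lemma horner_alg_monic (K : fieldType) (A : falgType K) (d : A) (f : {poly K}) n :
  f \is monic -> size f = n.+1 -> horner_alg d f = d ^+ n + \sum_(k < n) f`_k *: d ^+ k.
Proof.
move=> /monicP; rewrite lead_coefE => lf sf.
rewrite -[LHS]/((map_poly (in_alg A) f).[d]) (horner_coef_wide d (n := n.+1)); last first.
  by rewrite -sf size_map_poly.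
rewrite big_ord_recr /= [LHS]addrC; congr (_ + _).
  by move: lf; rewrite sf coef_map /= => ->; rewrite scale1r mul1r.
by apply: eq_bigr => k _; rewrite coef_map /= mulr_algl.
Qed.

(** * Companion matrices and twisted norms in their commutant *)

Section Companion.
Variables (R : comNzRingType) (q : nat) (a : 'I_q.+1 -> R).

Definition compan : 'M[R]_q.+1 :=
  \matrix_(k, j) if k == q :> nat then - a j else (j == k.+1 :> nat)%:R.

Lemma delta_compan (k : 'I_q.+1) : (k < q)%N -> delta_mx 0 k *m compan = delta_mx 0 (inord k.+1) :> 'rV_q.+1.
Proof.
move=> ltk; rewrite -rowE; apply/rowP => j; rewrite !mxE ltn_eqF // eqxx /=.
by rewrite -val_eqE /= inordK.
Qed.

Lemma delta_companX k : (k < q.+1)%N -> delta_mx 0 0 *m compan ^+ k = delta_mx 0 (inord k) :> 'rV_q.+1.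
Proof.
elim: k => [|k IH] ltk.
  by rewrite expr0 mulmx1; congr delta_mx; apply: val_inj; rewrite /= inordK.
rewrite exprSr -mulmxE mulmxA IH ?(ltnW ltk) // delta_compan inordK ?(ltnW ltk) //.
Qed.

Lemma kry_compan : kry compan (delta_mx 0 0) = 1%:M.
Proof.
by apply/row_matrixP => i; rewrite rowK delta_companX // inord_val row1.
Qed.

Lemma delta_companXn : delta_mx 0 0 *m compan ^+ q.+1 = - \row_j a j :> 'rV_q.+1.
Proof.
rewrite exprSr -mulmxE mulmxA delta_companX // -rowE; apply/rowP => j.
by rewrite !mxE inordK // eqxx.
Qed.
End Companion.

(** All conjugates of [A] lie in the commutant of [C], which is commutative, so the order of the
    factors does not matter. *)
Lemma rnrm_mxnrm q (F : sfield q.+1) (C A : 'M[F]_q.+1) e m : kry C e = 1%:M -> map_mx (sg F) C = C ->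
  C *m A = A *m C -> rnrm (sg F) A m = mxnrm (sg F) m A.
Proof.
move=> cyc sC CA.
have E k : C *m mxnrm (sg F) k A = mxnrm (sg F) k A *m C /\
   mxnrm (sg F) k.+1 A = A *m map_mx (sg F) (mxnrm (sg F) k A).
  elim: k => [|k [IH1 IH2]].
    by rewrite /mxnrm big_ord_recl !big_ord0 mulmx1 mul1mx map_mx1 map_mx_id.
  split.
    rewrite IH2 mulmxA CA -!mulmxA; congr (_ *m _).
    by rewrite -[C in LHS]sC -map_mxM IH1 map_mxM sC.
  have -> : mxnrm (sg F) k.+2 A = mxnrm (sg F) k.+1 A *m map_mx (iter k.+1 (sg F)) A.
    by rewrite /mxnrm big_ord_recr.
  rewrite {1}IH2 -mulmxA; congr (_ *m _).
  have -> : mxnrm (sg F) k.+1 A = mxnrm (sg F) k A *m map_mx (iter k (sg F)) A.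
    by rewrite /mxnrm big_ord_recr.
  by rewrite map_mxM -[map_mx _ (map_mx _ A)]map_mx_comp.
elim: m => [|m IH]; first by rewrite /mxnrm big_ord0.
rewrite /= IH (E m).2; have [E1 _] := E m.
apply: (comm_comm cyc) => //.
by rewrite -[C in LHS]sC -map_mxM E1 map_mxM sC.
Qed.

Lemma ci_zmod q (F : sfield q.+1) (b : fixfld F) : zmod_morphism (ci b).
Proof. by move=> l l'; rewrite /ci scalerBl. Qed.
Lemma ci_monoid q (F : sfield q.+1) (b : fixfld F) : monoid_morphism (ci b).
Proof. by split=> [|l l']; [rewrite /ci scale1r|rewrite ciM]. Qed.
HB.instance Definition _ q F b := GRing.isZmodMorphism.Build _ _ (@ci q F b) (@ci_zmod q F b).
HB.instance Definition _ q F b := GRing.isMonoidMorphism.Build _ _ (@ci q F b) (@ci_monoid q F b).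

Section Transfer.
Variables (q : nat) (F : sfield q.+1) (b b' : fixfld F) (i j : nat).
Let p := q.+1.
Hypotheses (pp : prime p) (closedF : forall t : task q F, valid t -> solved t).
Hypotheses (bi : fval F b = bb F i) (b'j : fval F b' = bb F j) (ij : i <> j).
Hypothesis div' : is_division (calg b').
Variable f : {poly fixfld F}.
Hypotheses (fm : f \is monic) (sf : size f = p.+1) (irf : irreducible_poly f).
Let fF := map_poly (fval F) f.
Let C := compan (fun k : 'I_p => fF`_k).
Local Notation V := 'rV[F]_q.+1.

Let sC : map_mx (sg F) C = C.
Proof.
apply/matrixP => k l; rewrite !mxE; case: ifP => _; last by rewrite rmorph_nat.
by rewrite rmorphN /= coef_map fvalK.
Qed.
Let cyc : kry C (delta_mx 0 0) = 1%:M := kry_compan _.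

Section Forward.
Variable d : calg b.
Hypothesis fd : horner_alg d f = 0.
Hypothesis cop : forall h : {poly F}, h != 0 -> (size h <= p)%N -> coprimep fF h.

(* The matrix of [evd], in the basis [1, X, ..., X^(p-1)] of [F[X]/(fF)]; multiplication by [X] is [C]. *)
Let Md : 'M[F]_q.+1 := \matrix_(k < q.+1) (d ^+ k : V).

Let evd (g : {poly F}) : calg b := (map_poly (ci b) g).[d].

(** Evaluation at [d] is not multiplicative, as [d] need not commute with [F]; but with coefficients
    on the left its kernel is still an ideal. *)
Let evd_ideal u g : evd g = 0 -> evd (u * g) = 0.
Proof.
move=> g0; elim/poly_ind: u => [|u c IH]; first by rewrite mul0r /evd rmorph0 horner0.
rewrite mulrDl /evd rmorphD hornerD -mulrA -['X * g]mulrC mulrA !rmorphM /= map_polyX hornerMX.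
rewrite -rmorphM -/(evd _) IH mul0r add0r map_polyC hornerCM -/(evd _) g0 mulr0 //.
Qed.

Let evd_row (c : V) : evd (rVpoly c) = (c *m Md : V).
Proof.
rewrite /evd (horner_coef_wide d (n := q.+1)); last first.
  by rewrite (leq_trans (size_poly _ _)) // size_poly.
rewrite mulmx_sum_row; apply: eq_bigr => k _.
by rewrite rowK coef_map coef_rVpoly_ord ci_mul.
Qed.

Let evd_fF : evd fF = 0.
Proof.
rewrite -fd /evd /fF -map_poly_comp.
by congr (_.[d]); apply: eq_map_poly => k /=; rewrite calg_scale_ci.
Qed.

(** A linear relation between the powers of [d] is a polynomial of degree less than [p] killed by
    [evd]. It is coprime to [fF], so Bezout would give [1 = 0]. *)
Let Md_unit : Md \in unitmx.
Proof.
rewrite -row_free_unit -kermx_eq0; apply: contrapT => /negP/rowV0Pn[c /sub_kermxP cM c0].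
have h0 : rVpoly c != 0 by apply: contraNneq c0 => h0; rewrite -[c]rVpolyK h0 linear0.
have /Bezout_eq1_coprimepP[[u v] /= uv] := cop h0 (size_poly _ _).
have /eqP := oner_neq0 (calg b); apply.
have <- : evd 1 = 1 by rewrite /evd rmorph1 hornerC.
rewrite -uv /evd rmorphD hornerD -!/(evd _) !evd_ideal ?addr0 ?evd_fF //.
by rewrite evd_row cM.
Qed.

Let R := mulrmx d.

(** On the basis of powers of [d], right multiplication by [d] is the companion matrix, since [f]
    has central coefficients. *)
Let MdC : C *m Md = Md *m R.
Proof.
apply/row_matrixP => k; rewrite [RHS]row_mul rowK -mulrmxE -exprSr row_mul.
rewrite rowE; have [ek|nk] := eqVneq (k : nat) q; last first.
  have ltk : (k < q)%N by rewrite ltn_neqAle nk -ltnS /=.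
  by rewrite delta_compan // -rowE rowK inordK.
have -> : k = inord q by apply: val_inj; rewrite /= inordK.
rewrite -(delta_companX (fun k : 'I_p => fF`_k) (k := q)) // -[_ *m _ *m C]mulmxA.
rewrite -[C ^+ q *m C]exprSr delta_companXn mulNmx inordK //.
have -> : d ^+ q.+1 = - (\sum_(k < q.+1) f`_k *: d ^+ k) :> calg b.
  by apply/eqP; rewrite -addr_eq0 -(horner_alg_monic d fm sf) fd.
congr (- _); rewrite mulmx_sum_row; apply: eq_bigr => l _.
by rewrite rowK mxE coef_map.
Qed.

(** The matrix of left multiplication by [y], a semilinear map, on the basis of powers of [d]. *)
Let H := map_mx (sg F) Md *m shiftmx b *m invmx Md.

Let HMd : H *m Md = map_mx (sg F) Md *m shiftmx b.
Proof. by rewrite /H mulmxKV. Qed.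

Let SR : shiftmx b *m R = map_mx (sg F) R *m shiftmx b.
Proof.
apply/row_matrixP => k; have := fy_mulrmx (delta_mx 0 k) d; rewrite /fy !map_mxM map_delta_mx.
by rewrite -!mulmxA -!rowE.
Qed.

Let CH : C *m H = H *m C.
Proof.
move: HMd; move: (H) => H' HM; apply: (can_inj (mulmxK Md_unit)).
rewrite -!mulmxA HM MdC [RHS]mulmxA HM -mulmxA SR.
by rewrite !mulmxA -map_mxM -MdC map_mxM sC.
Qed.

Let Hnorm : mxnrm (sg F) p H = (bb F i)%:M.
Proof.
rewrite -(rnrm_mxnrm p cyc sC CH); apply: (can_inj (mulmxK Md_unit)).
rewrite -(rnrm_iter p (esym HMd)) -bi mul_scalar_mx.
have E m k : row k (iter m (fun N : 'M_q.+1 => map_mx (sg F) N *m shiftmx b) Md) =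
    iter m (fy b) (row k Md).
  by elim: m => //= m <-; rewrite row_mul -map_row.
by apply/row_matrixP => k; rewrite E iter_fy_p [RHS]linearZ.
Qed.

Lemma transfer_solved : exists Z, C *m Z = Z *m C /\ mxnrm (sg F) p Z = (bb F j)%:M.
Proof. exact: (closedF (t := Task C H i j)) (And5 ij sC CH cyc Hnorm). Qed.

End Forward.

(** Letting [y] act by [zy] makes the row space a module over [calg b'], free of rank one on [e0].
    The map [C] commutes with this action, so it is right multiplication by an element, which
    inherits the equation of [C]. *)
Lemma solved_root (Z : 'M[F]_q.+1) : C *m Z = Z *m C -> mxnrm (sg F) p Z = (bb F j)%:M ->
  exists d' : calg b', horner_alg d' f = 0.
Proof.
move=> CZ nZ; pose zy (v : V) := map_mx (sg F) v *m Z.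
pose e0 : V := delta_mx 0 0.
(* The matrix of the module map that sends [u] to [u] acting on [e0]. *)
pose W : 'M[F]_q.+1 := \matrix_(k < q.+1) iter k zy e0.
have zyp : iter p zy e0 = fval F b' *: e0.
  have e : map_mx (sg F) (1%:M : 'M[F]_q.+1) *m Z = Z *m 1%:M by rewrite map_mx1 mulmx1 mul1mx.
  have := rnrm_iter p e; rewrite (rnrm_mxnrm p cyc sC CZ) nZ mulmx1 -b'j => h.
  have E m : row 0 (iter m (fun N : 'M_q.+1 => map_mx (sg F) N *m Z) 1%:M) = iter m zy e0.
    by elim: m => [|m IH]; rewrite ?row1 //= row_mul -map_row IH.
  by rewrite -E h -[(fval F b')%:M]scalemx1 linearZ /= row1.
have SW : shiftmx b' *m W = map_mx (sg F) W *m Z.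
  apply/row_matrixP => k; rewrite [RHS]row_mul -map_row rowK -/(zy _) -iterS.
  rewrite row_mul; have [ek|nk] := eqVneq (k : nat) q.
    rewrite ek zyp; have -> : row k (shiftmx b') = fval F b' *: e0.
      by apply/rowP => l; rewrite !mxE ek eqxx mulrC -val_eqE.
    by rewrite -scalemxAl -rowE rowK.
  have ltk : (k < q)%N by rewrite ltn_neqAle nk -ltnS /=.
  have -> : row k (shiftmx b') = delta_mx 0 (inord k.+1).
    by apply/rowP => l; rewrite !mxE ltn_eqF // eqxx -[l == inord _]val_eqE /= inordK.
  by rewrite -rowE rowK inordK.
have fyW v : fy b' v *m W = zy (v *m W).
  by rewrite /fy /zy -mulmxA SW map_mxM mulmxA.
have iterW m v : iter m (fy b') v *m W = iter m zy (v *m W).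
  by elim: m => //= m <-; rewrite fyW.
have mulW (u v : calg b') : (u * v : V) *m W = \sum_(k < q.+1) (u : V) 0 k *: iter k zy ((v : V) *m W).
  rewrite -[u * v]/(cmul u v) /cmul mulmx_suml; apply: eq_bigr => k _.
  by rewrite -scalemxAl iterW.
have zy0 m : iter m zy 0 = 0 by elim: m => //= m ->; rewrite /zy map_mx0 mul0mx.
have e0W : e0 *m W = e0 by rewrite -rowE rowK.
(* A nonzero [c] killing [e0] is invertible in the division algebra, and then [1] would kill
   [e0]. *)
have W_unit : W \in unitmx.
  rewrite -row_free_unit -kermx_eq0; apply: contrapT => /negP/rowV0Pn[c /sub_kermxP cW c0].
  have cu : (c : calg b') \is a GRing.unit by apply: div'.
  have := mulW (c : calg b')^-1 c; rewrite mulVr // cW.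
  rewrite big1 => [|k _]; last by rewrite zy0 scaler0.
  rewrite [LHS]e0W => /rowP/(_ 0); rewrite !mxE !eqxx => /eqP.
  by rewrite oner_eq0.
(* The element that acts on [e0] as [C] does. *)
pose d' : calg b' := (e0 *m C *m invmx W : V).
have d'W : (d' : V) *m W = e0 *m C by rewrite mulmxKV.
have zyC v : zy (v *m C) = zy v *m C by rewrite /zy map_mxM sC -!mulmxA CZ.
have izyC m v : iter m zy (v *m C) = iter m zy v *m C by elim: m => //= m ->; rewrite zyC.
have dXW k : (d' ^+ k : V) *m W = e0 *m C ^+ k.
  elim: k => [|k IH]; first by rewrite mulmx1 -[RHS]e0W.
  rewrite exprSr mulW d'W [in RHS]exprSr -mulmxE mulmxA -IH.
  under eq_bigr => l _ do rewrite izyC scalemxAl.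
  rewrite -mulmx_suml; congr (_ *m C).
  have := mulW (d' ^+ k) 1; rewrite mulr1 => ->.
  by apply: eq_bigr => l _; rewrite -[X in iter l zy X]e0W.
exists d'; rewrite (horner_alg_monic d' fm sf).
apply: (can_inj (mulmxK W_unit)); rewrite mul0mx.
rewrite -[_ + _]/((d' ^+ p : V) + (\sum_(k < p) f`_k *: d' ^+ k : V)) mulmxDl dXW delta_companXn.
rewrite mulmx_suml addrC; apply/eqP; rewrite subr_eq0; apply/eqP.
rewrite [RHS]row_sum_delta; apply: eq_bigr => k _.
rewrite -[(f`_k *: d' ^+ k : calg b')]/(fval F f`_k *: (d' ^+ k : V)) -scalemxAl dXW.
by rewrite delta_companX // inord_val mxE coef_map.
Qed.

(** When [f] has a root in [F], that root serves directly, because [F] sits in every [calg b']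
    through [ci]. *)
Lemma transfer (d : calg b) : horner_alg d f = 0 -> exists d' : calg b', horner_alg d' f = 0.
Proof.
move=> fd; have [[r rr]|cop] := irr_root_or_coprime pp sf irf; last first.
  have [Z [CZ nZ]] := transfer_solved fd cop; exact: solved_root CZ nZ.
exists (ci b' r).
have -> : horner_alg (ci b' r) f = ci b' fF.[r].
  rewrite -[RHS]horner_map -map_poly_comp -[LHS]/((map_poly (in_alg _) f).[_]).
  by congr (_.[_]); apply: eq_map_poly => k /=; rewrite calg_scale_ci.
by rewrite (rootP rr) rmorph0.
Qed.

End Transfer.

(** * The genus *)

Lemma bb_not_norm p (F : sfield p) i c : prime p -> nrm (sg F) p c <> bb F i.
Proof.
move=> pp e; have lti := ltnSn i.
have := @bb_indep p F i.+1 (fun k => 0 + (k == i) * 1)%N c _ i lti.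
rewrite eqxx dvdn1 -(bb_prod_mul F (fun=> 0%N)) // e => h.
have /eqP p1 : p == 1%N by apply: h; rewrite big1 ?mul1r ?expr1 // => k _; rewrite expr0.
by move: pp; rewrite p1.
Qed.

(** Multiplying by [b_j^(p-1)] would make [b_i b_j^(p-1)] the norm of [l b_j], although its exponent
    at [i] is 1. *)
Lemma bb_ratio_not_norm p (F : sfield p) i j l : prime p -> i <> j ->
  bb F i <> nrm (sg F) p l * bb F j.
Proof.
move=> pp ij e; have p0 := prime_gt0 pp; pose N := (maxn i j).+1.
have ltiN : (i < N)%N by rewrite ltnS leq_maxl.
have ltjN : (j < N)%N by rewrite ltnS leq_maxr.
have := @bb_indep p F N (fun k => 0 + (k == i) * 1 + (k == j) * p.-1)%N (l * bb F j) _ i ltiN.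
rewrite eqxx (introF eqP ij) mul1n mul0n add0n addn0 dvdn1.
rewrite -(bb_prod_mul F (fun k => 0 + (k == i) * 1)%N) // -(bb_prod_mul F (fun=> 0%N)) // => h.
have /eqP p1 : p == 1%N.
  apply: h; rewrite big1 => [|k _]; last by rewrite expr0.
  by rewrite mul1r expr1 nrmM (nrm_fix _ (sg_bb F j)) e -mulrA -exprS prednK.
by move: pp; rewrite p1.
Qed.

Theorem theorem4 (p : nat) : prime p ->
  exists (K : fieldType) (D : falgType K),
    central_division_of_degree p D /\ genus_infinite p D.
Proof.
case: p => // q pp.
(* Matrices of size [p] suffice, as they are the companion matrices of generators of extensions of
   degree [p]. *)
have [F closedF] := @closed_sfield q.+1 q isT.
have [bK bKE] : {bK : nat -> fixfld F | forall i, fval F (bK i) = bb F i}.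
  have h i : {k | fval F k = bb F i} by apply/cid/fval_ex/sg_bb.
  by exists (fun i => projT1 (h i)) => i; exact: projT2 (h i).
pose Ds i : falgType (fixfld F) := calg (bK i).
have div i : is_division (Ds i).
  by apply: (calg_division pp) => c; rewrite bKE; exact: bb_not_norm.
have cdd i : central_division_of_degree q.+1 (Ds i).
  by split; [exact: div | apply: calg_central; rewrite bKE; exact: bb_neq0 | exact: dim_calg].
(* One direction for arbitrary [i] and [j] is enough: exchanging them gives the other. *)
have emb (E : fieldExtType (fixfld F)) i j : \dim {:E} = q.+1 ->
    embeds_into E (Ds i) -> embeds_into E (Ds j).
  move=> dE [g _]; have [<-|/eqP ij] := eqVneq i j; first by exists g.
  have [th [f [fm sf irf fth emb]]] := embed_gen pp dE.
  have fd : horner_alg (g th : Ds i) f = 0.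
    rewrite -[LHS]/((map_poly (in_alg (Ds i)) f).[g th]) -(rmorph0 g) -fth.
    rewrite -[horner_alg th f]/((map_poly (in_alg E) f).[th]) -horner_map -map_poly_comp.
    by congr (_.[_]); apply: eq_map_poly => k; rewrite /= linearZ /= rmorph1.
  have [d' fd'] := transfer pp closedF (bKE i) (bKE j) ij (div j) fm sf irf fd.
  exact: emb fd'.
exists (fixfld F), (Ds 0%N); split; first exact: cdd.
exists Ds; split=> [i|i j ij [g _]]; first by split=> [|E dE]; [exact: cdd | split; exact: emb].
have [l] := calg_hom_norm g (prime_gt1 pp) (div j).
by rewrite !bKE; exact: bb_ratio_not_norm pp ij.
Qed.
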